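(* There is an absolute constant $K$ such that the following holds. Let $n\ge4$ and let $U$ be a unitary on $n$ qubits given by a Clifford+T circuit with $T$-depth $D\ge1$ and $T$-count $C$. Then the controlled unitary $c(U)$ can be implemented, without ancillas, by a Clifford+T circuit with $T$-depth at most $KD$ and $T$-count at most $K(C+n)$ (i.e. with $T$-depth $O(D)$ and $T$-count $O(C+n)$).
   Context: A Clifford circuit is a circuit of gates $H$, $S=\mathrm{diag}(1,i)$ and CNOT. $T=\mathrm{diag}(1,e^{i\pi/4})$. For a unitary $U$ on $n$ qubits, $c(U)$ is the unitary on $n+1$ qubits with $c(U)(|0\rangle\otimes|\psi\rangle)=|0\rangle\otimes|\psi\rangle$ and $c(U)(|1\rangle\otimes|\psi\rangle)=|1\rangle\otimes U|\psi\rangle$. A Clifford+T circuit is a unitary circuit of gates $H$, $S$, CNOT, $T$, $T^\dagger$ (no measurements). A circuit of $T$-depth $D$ and $T$-count $C$ is one of the form $K_DL_DK_{D-1}\cdots K_1L_1K_0$ where each $K_j$ is a Clifford circuit and each $L_j$ is a product of $T$ and $T^\dagger$ gates on distinct qubits, with $C$ such gates in total. ''Without ancillas'' means that the circuit for $c(U)$ acts only on the $n+1$ qubits of $c(U)$. *)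

(* Defs.v *)
From HB Require Import structures.
From mathcomp Require Import all_boot all_order all_algebra.
From mathcomp Require Import complex.
From mathcomp Require Import reals trigo.

Set Implicit Arguments.
Unset Strict Implicit.
Unset Printing Implicit Defensive.

Import Order.TTheory GRing.Theory Num.Theory.
Local Open Scope ring_scope.
Local Open Scope complex_scope.

(* The computational basis of n qubits is n.-tuple bool; matrices are indexed
   through its enumeration, so that qdim n is 2 ^ n (qdimE). *)
Definition qdim (n : nat) : nat := #|{: n.-tuple bool}|.

Definition bits (n : nat) (i : 'I_(qdim n)) : n.-tuple bool := enum_val i.

Lemma qdimE (n : nat) : qdim n = (2 ^ n)%N.
Proof. by rewrite /qdim card_tuple card_bool. Qed.

(* The operator whose entry <x| A |y> is f x y. *)
Definition opmx (R : realType) (n : nat)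
    (f : n.-tuple bool -> n.-tuple bool -> R[i]) : 'M[R[i]]_(qdim n) :=
  \matrix_(i, j) f (bits i) (bits j).

(* The entry <a| G |b> of a 2 x 2 matrix. *)
Definition entry (R : realType) (G : 'M[R[i]]_2) (a b : bool) : R[i] :=
  G (inord a) (inord b).

Definition hadamard_mx (R : realType) : 'M[R[i]]_2 :=
  \matrix_(i, j) ((-1) ^+ (i * j) / sqrtC 2).

(* diag (1, a) *)
Definition phase_mx (R : realType) (a : R[i]) : 'M[R[i]]_2 :=
  diag_mx (\row_(j < 2) a ^+ j).

(* e ^ (i pi / 4) *)
Definition omega (R : realType) : R[i] := cos (pi / 4) +i* sin (pi / 4).

(* G on qubit q, identity on the other qubits. *)
Definition on_qubit (R : realType) (n : nat) (q : 'I_n) (G : 'M[R[i]]_2) :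
    'M[R[i]]_(qdim n) :=
  opmx (fun x y =>
    if [forall r : 'I_n, (r != q) ==> (tnth x r == tnth y r)]
    then entry G (tnth x q) (tnth y q) else 0).

(* |y> is sent to |y'>, where y' is y with bit t replaced by y_t (+) y_c. *)
Definition cnot_mx (R : realType) (n : nat) (c t : 'I_n) : 'M[R[i]]_(qdim n) :=
  opmx (fun x y =>
    (x == [tuple tnth y r (+) ((r == t) && tnth y c) | r < n])%:R).

Inductive gate (n : nat) : Type :=
| GateH of 'I_n
| GateS of 'I_n
| GateCNOT (control target : 'I_n) of control != target
| GateT of 'I_n
| GateTdg of 'I_n.

Definition gate_mx (R : realType) (n : nat) (g : gate n) : 'M[R[i]]_(qdim n) :=
  match g with
  | GateH q => on_qubit q (hadamard_mx R)
  | GateS q => on_qubit q (phase_mx 'i)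
  | GateCNOT c t _ => cnot_mx R c t
  | GateT q => on_qubit q (phase_mx (omega R))
  | GateTdg q => on_qubit q (phase_mx (omega R)^*)
  end.

Definition is_T (n : nat) (g : gate n) : bool :=
  match g with GateT _ | GateTdg _ => true | _ => false end.

Definition gate_qubits (n : nat) (g : gate n) : seq 'I_n :=
  match g with
  | GateH q | GateS q | GateT q | GateTdg q => [:: q]
  | GateCNOT c t _ => [:: c; t]
  end.

(* Circuits are listed in the order of the operator product: the head of the
   list is the leftmost factor, hence the gate that acts last. *)
Definition circuit (n : nat) : Type := seq (gate n).

Definition circuit_mx (R : realType) (n : nat) (w : circuit n) :
    'M[R[i]]_(qdim n) :=
  foldr (fun g A => gate_mx R g *m A) 1%:M w.

Definition clifford_circuit (n : nat) (w : circuit n) : bool :=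
  all (fun g => ~~ is_T g) w.

Definition T_layer (n : nat) (l : circuit n) : bool :=
  all (@is_T n) l && uniq (flatten [seq gate_qubits g | g <- l]).

(* w = K_D L_D K_(D-1) ... K_1 L_1 K_0, with C gates in the T layers L_j. *)
Inductive clifford_T_form (n : nat) : circuit n -> nat -> nat -> Prop :=
| CliffordTForm0 (k : circuit n) :
    clifford_circuit k -> clifford_T_form k 0 0
| CliffordTFormS (k l w : circuit n) (D C : nat) :
    clifford_circuit k -> T_layer l -> clifford_T_form w D C ->
    clifford_T_form (k ++ l ++ w) D.+1 (size l + C).

(* The equality of operators is exact: no global phase is dropped. *)
Definition implements (R : realType) (n : nat) (U : 'M[R[i]]_(qdim n))
    (D C : nat) : Prop :=
  exists2 w : circuit n, clifford_T_form w D C & circuit_mx R w = U.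

Definition btail (n : nat) (x : n.+1.-tuple bool) : n.-tuple bool :=
  behead_tuple x.

(* The control is qubit 0, the head of the bit tuple; see controlled_mxE. *)
Definition controlled_mx (R : realType) (n : nat) (U : 'M[R[i]]_(qdim n)) :
    'M[R[i]]_(qdim n.+1) :=
  opmx (fun x y =>
    if thead x == thead y then
      (if thead x then U else 1%:M)
        (enum_rank (btail x)) (enum_rank (btail y))
    else 0).

(* |b> (x) psi *)
Definition ket_tens (R : realType) (n : nat) (b : bool)
    (psi : 'cV[R[i]]_(qdim n)) : 'cV[R[i]]_(qdim n.+1) :=
  \col_i (if thead (bits i) == b
          then psi (enum_rank (btail (bits i))) 0 else 0).

Lemma controlled_mxE (R : realType) (n : nat) (U : 'M[R[i]]_(qdim n))
    (b : bool) (psi : 'cV[R[i]]_(qdim n)) :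
  controlled_mx U *m ket_tens b psi = ket_tens b (if b then U *m psi else psi).
Proof.
have -> : (if b then U *m psi else psi) = (if b then U else 1%:M) *m psi.
  by case: b; rewrite ?mul1mx.
apply/matrixP => i j; rewrite !ord1 !mxE.
under eq_bigr => k _ do rewrite !mxE.
case: eqVneq => [hb|hb]; last first.
  rewrite big1 // => k _; case: eqVneq => [hk|_]; last by rewrite mul0r.
  by rewrite -hk (negPf hb) mulr0.
rewrite hb.
pose h (k : 'I_(qdim n)) : 'I_(qdim n.+1) :=
  enum_rank (cons_tuple b (bits k)).
pose h' (k : 'I_(qdim n.+1)) : 'I_(qdim n) :=
  enum_rank (btail (bits k)).
have hK k : h' (h k) = k.
  rewrite /h' /h /bits enum_rankK -[RHS]enum_valK; congr enum_rank.
  exact: val_inj.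
rewrite (bigID (fun k => thead (bits k) == b)) /= [X in _ + X]big1 ?addr0.
  rewrite (reindex_onto h h') /=; last first.
    move=> k /eqP hk; rewrite /h /h' /bits enum_rankK -[RHS]enum_valK.
    by congr enum_rank; rewrite [RHS]tuple_eta -hk; apply: val_inj.
  apply: eq_big => [k|k /andP[hk _]].
    by rewrite hK eqxx andbT /h /bits enum_rankK theadE eqxx.
  rewrite (eqP hk) eqxx.
  by rewrite -[enum_rank (btail (bits (h k)))]/(h' (h k)) hK.
by move=> k hk; rewrite (negPf hk) mulr0.
Qed.

(* Main.v *)
Require Import Defs.
From HB Require Import structures.
From mathcomp Require Import all_boot all_order all_algebra all_fingroup.
From mathcomp Require Import complex.
From mathcomp Require Import reals trigo.
From mathcomp Require Import ring zify.

(* Write U = K_D L_D ... L_1 K_0 as a product of Clifford conjugates of the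
   T layers L_j followed by a single Clifford K.  Since
   c(A B A^-1) = A c(B) A^-1, it suffices to control one T layer with T-depth
   O(1) and T-count linear in its size, and one Clifford with T-depth O(1) and
   T-count O(n).

   Cliffords.  A layer of S gates on a set of qubits is, up to a power of
   omega, the commutator of a T layer with a Pauli operator X, and c(X) is
   Clifford.  Every Clifford is, up to a Pauli and a phase, a product of a
   bounded number of Clifford conjugates of S layers.  This is a statement on
   the symplectic group over F_2: a symplectic matrix is l(X) d(A) u(Y) l(Z)
   with X, Y, Z symmetric and A invertible; u(X) is reduced to diagonal
   matrices by X = M M^T + diagonal; d(A) is a product of matrices u and l when
   A is symmetric; and every invertible A is a product of 12 symmetric
   matrices, because A = V L W with unitriangular factors, and a unitriangular
   matrix times the cyclic shift is a Hessenberg matrix, which is a product of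
   two symmetric ones.  The remaining phase is a root of unity in Q(omega),
   hence a power of omega.

   T layers.  The commutator of T gates on half of the qubits of the layer with
   the exchange of the two halves is T on one half and T^-1 on the other, so
   only Cliffords on the qubits of the layer need a control.  If the number of
   qubits is odd, one c(T) remains.  It is built from Toffoli gates on five
   qubits, whence the assumption n >= 4: borrowing a qubit z in an arbitrary
   state gives omega^(x y (1 - 2 z)), which leaves a phase i^(x y z), and in the
   same way i^(x y z) is reduced to (-1)^(x y z w). *)

Set Implicit Arguments.
Unset Strict Implicit.
Unset Printing Implicit Defensive.

Import Order.TTheory GRing.Theory Num.Theory.
Local Open Scope ring_scope.
Local Open Scope complex_scope.

(** * Products of symmetric matrices *)

Section FieldMatrices.
Variable F : fieldType.

(** [is_trig_mx] means lower triangular; upper unitriangular matrices are handled through their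
    transposes. *)
Definition uni_trig (n : nat) (L : 'M[F]_n) : Prop :=
  is_trig_mx L /\ forall i, L i i = 1.

Lemma uni_trig_unit (n : nat) (L : 'M[F]_n) : uni_trig L -> L \in unitmx.
Proof.
by case=> tL dL; rewrite unitmxE det_trig // big1 ?unitr1 // => i _; rewrite dL.
Qed.

Lemma uni_trig1 (n : nat) : uni_trig (1%:M : 'M[F]_n).
Proof. by split=> [|i]; rewrite ?scalar_mx_is_trig // !mxE eqxx. Qed.

Lemma uni_trig_block (n : nat) (c : 'cV[F]_n) (L : 'M[F]_n) :
  uni_trig L -> uni_trig (block_mx (1%:M : 'M_1) 0 c L).
Proof.
case=> tL dL; split; first by rewrite is_trig_block_mx // eqxx tL scalar_mx_is_trig.
move=> i; rewrite -(splitK i); case: (split i) => j /=.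
  by rewrite block_mxEul mxE ord1 eqxx.
by rewrite block_mxEdr.
Qed.

Lemma sym_congr (n : nat) (S T : 'M[F]_n) :
  S^T = S -> (T *m S *m T^T)^T = T *m S *m T^T.
Proof. by move=> sS; rewrite !trmx_mul trmxK sS mulmxA. Qed.

(** The number of symmetric factors is recorded because it enters the absolute constant of the cost
    bound. *)
Inductive sym_prod (n : nat) : nat -> 'M[F]_n -> Prop :=
| SymProd1 A : A^T = A -> A \in unitmx -> sym_prod 1 A
| SymProdM k l A B :
    sym_prod k A -> sym_prod l B -> sym_prod (k + l) (A *m B).

Lemma sym_prod_unit (n k : nat) (A : 'M[F]_n) : sym_prod k A -> A \in unitmx.
Proof. by elim=> // k1 l A1 B _ uA _ uB; rewrite unitmx_mul uA. Qed.

Lemma sym_prod_tr (n k : nat) (A : 'M[F]_n) : sym_prod k A -> sym_prod k A^T.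
Proof.
elim=> [A1 sA uA|k1 l A1 B _ IA _ IB]; first by rewrite sA; apply: SymProd1.
by rewrite trmx_mul addnC; apply: SymProdM.
Qed.

Lemma invmx_mul (n : nat) (A B : 'M[F]_n) : A \in unitmx -> B \in unitmx ->
  invmx (A *m B) = invmx B *m invmx A.
Proof.
move=> uA uB; have uAB : A *m B \in unitmx by rewrite unitmx_mul uA.
rewrite -[RHS](mulmxK uAB) -[X in _ = X *m _]mulmxA (mulmxA (invmx A)).
by rewrite mulVmx // mul1mx mulVmx // mul1mx.
Qed.

Lemma sym_prod_inv (n k : nat) (A : 'M[F]_n) :
  sym_prod k A -> sym_prod k (invmx A).
Proof.
elim=> [A1 sA uA|k1 l A1 B pA IA pB IB].
  by apply: SymProd1; rewrite ?unitmx_inv // trmx_inv sA.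
have [uA uB] := (sym_prod_unit pA, sym_prod_unit pB).
by rewrite invmx_mul //; rewrite addnC; apply: SymProdM.
Qed.

Definition unit_hessenberg (n : nat) (H : 'M[F]_n.+1) : Prop :=
  forall i j : 'I_n.+1, (j < i)%N -> H i j = (i == j.+1 :> nat)%:R.

(** Left multiplication by [H] pushes the lowest nonzero diagonal one step down: in the sum for row
    i + 1, the terms of index below i vanish because [H] is Hessenberg, and those above i vanish by
    induction. *)
Lemma hessenberg_expr (n k : nat) (H : 'M[F]_n.+1) (i j : 'I_n.+1) :
  unit_hessenberg H -> (j + k <= i)%N ->
  (H ^+ k) i j = (i == (j + k)%N :> nat)%:R.
Proof.
move=> hH; elim: k i => [|k IH] i le_i.
  by rewrite expr0 mxE addn0 (inj_eq val_inj).
rewrite exprS mxE; case: i le_i => [[|i]] lt_i le_i; first by rewrite addnS in le_i.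
rewrite (bigD1 (Ordinal (ltnW lt_i))) //= hH //= eqxx mul1r IH /=; last by rewrite -ltnS -addnS.
rewrite addnS eqSS big1 ?addr0 // => l ne_l.
case: (ltngtP l i) => [lt|gt|eq_l]; last by rewrite -val_eqE /= eq_l eqxx in ne_l.
  by rewrite hH /= ?eqSS ?(gtn_eqF lt) ?mul0r // ltnW // ltnS.
rewrite IH; last by apply: ltnW; apply: leq_trans gt; rewrite -ltnS -addnS.
suff /negbTE-> : (l != j + k :> nat)%N by rewrite mulr0.
by rewrite neq_ltn orbC (leq_ltn_trans _ gt) // -ltnS -addnS.
Qed.

(* With [P = (e_0, H e_0, H^2 e_0, ...)] and [Q] the matrix of rows
   [e_n^T H^i], both [Q P] and [Q H P] are Hankel matrices, hence symmetric. *)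
Lemma hessenberg_sym_prod (n : nat) (H : 'M[F]_n.+1) :
  unit_hessenberg H -> H \in unitmx -> sym_prod 2 H.
Proof.
move=> hH uH.
pose P : 'M[F]_n.+1 := \matrix_(i, j) (H ^+ j) i 0.
pose Q : 'M[F]_n.+1 := \matrix_(i, j) (H ^+ i) ord_max j.
have QP i j : (Q *m P) i j = (H ^+ (i + j)) ord_max 0.
  by rewrite exprD !mxE; apply: eq_bigr => k _; rewrite !mxE.
have QHP i j : (Q *m H *m P) i j = (H ^+ (i + j.+1)) ord_max 0.
  rewrite -mulmxA exprD !mxE; apply: eq_bigr => k _; rewrite !mxE exprS !mxE.
  by congr (_ * _); apply: eq_bigr => l _; rewrite !mxE.
have uP : P \in unitmx.
  rewrite -unitmx_tr; apply: uni_trig_unit; split.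
    apply/is_trig_mxP => i j lt_ij; rewrite !mxE hessenberg_expr //= ?add0n 1?ltnW //.
    by rewrite gtn_eqF.
  by move=> i; rewrite !mxE hessenberg_expr //= add0n eqxx.
have uQP : Q *m P \in unitmx.
  (* [Q *m P] is zero for i + j < n and one for i + j = n, so reversing its columns with [R] makes
     it lower unitriangular. *)
  pose R : 'M[F]_n.+1 := \matrix_(i, j) (i == rev_ord j)%:R.
  suff : Q *m P *m R \in unitmx by rewrite unitmx_mul => /andP[].
  have QPR i j : (Q *m P *m R) i j = (Q *m P) i (rev_ord j).
    rewrite mxE (bigD1 (rev_ord j)) //= [R _ _]mxE eqxx mulr1 big1 ?addr0 // => k ne_k.
    by rewrite [R _ _]mxE (negPf ne_k) mulr0.
  apply: uni_trig_unit; split.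
    apply/is_trig_mxP => i j lt_ij; rewrite QPR QP hessenberg_expr //= add0n subSS.
      rewrite gtn_eqF // -(ltn_add2r j) -addnA subnK; last by rewrite -ltnS.
      by rewrite addnC ltn_add2l.
    rewrite -(leq_add2r j) -addnA subnK; last by rewrite -ltnS.
    by rewrite addnC leq_add2l ltnW.
  move=> i; rewrite QPR QP hessenberg_expr //= add0n subSS subnKC ?eqxx //; by rewrite -ltnS.
have uQ : Q \in unitmx by move: uQP; rewrite unitmx_mul => /andP[].
have sQP : (Q *m P)^T = Q *m P by apply/matrixP=> i j; rewrite mxE !QP addnC.
have sQHP : (Q *m H *m P)^T = Q *m H *m P.
  by apply/matrixP=> i j; rewrite mxE !QHP -!addSnnS addnC addSnnS addnC addSnnS addnC.
(* Both factors are congruent to Hankel matrices; the second one equals Q^T P^-1, since (Q P)^T =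
   P^T Q^T. *)
have -> : H = (invmx Q *m (Q *m H *m P) *m invmx Q^T) *m
              ((invmx P^T) *m (Q *m P)^T *m invmx P).
  rewrite trmx_mul !mulmxA mulVmx // mul1mx.
  rewrite -[_ *m invmx P^T *m P^T]mulmxA mulVmx ?unitmx_tr // mulmx1.
  by rewrite -[_ *m invmx Q^T *m Q^T]mulmxA mulVmx ?unitmx_tr // mulmx1 mulmxK.
apply: (@SymProdM _ 1 1); apply: SymProd1.
- by rewrite -trmx_inv sym_congr.
- by rewrite !unitmx_mul unitmx_inv uQ uH uP unitmx_inv unitmx_tr uQ.
- by rewrite -trmx_inv -{2}[invmx P]trmxK sym_congr // trmxK.
- by rewrite !unitmx_mul !unitmx_inv !unitmx_tr unitmx_mul uQ uP.
Qed.

(** With C the cyclic shift, L^T = (L^T C) C^-1, and both L^T C and C = 1 C are invertible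
    Hessenberg matrices, with two symmetric factors each. *)
Lemma uni_trig_sym_prod (n : nat) (L : 'M[F]_n) : uni_trig L -> sym_prod 4 L.
Proof.
case: n L => [|n] L uL.
  have p1 : sym_prod 1 (1%:M : 'M[F]_0) by apply: SymProd1; rewrite ?trmx1 ?unitmx1.
  have -> : L = 1%:M *m 1%:M *m (1%:M *m 1%:M) by apply/matrixP=> -[].
  by do 2?apply: (@SymProdM _ 2 2); do 2?apply: (@SymProdM _ 1 1).
rewrite -[L]trmxK; apply: sym_prod_tr.
have [tL dL] := uL.
have uLT : L^T \in unitmx by rewrite unitmx_tr uni_trig_unit.
(* Right multiplication by [C] moves column j + 1 to place j, so the unit diagonal lands on the
   subdiagonal; column 0 wraps to the last place, whose entries all lie on or above the diagonal. *)
pose C : 'M[F]_n.+1 := perm_mx (perm (can_inj (@ord_predK n.+1))).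
have uC : C \in unitmx by apply: unitmx_perm.
have CE (V : 'M[F]_n.+1) i j : (V *m C) i j = V i (ordS j).
  rewrite mxE (bigD1 (ordS j)) //= !mxE permE ordSK eqxx mulr1 big1 ?addr0 //.
  move=> k ne_k; rewrite !mxE permE.
  case: eqP => [e|]; last by rewrite mulr0.
  by rewrite -e ord_predK eqxx in ne_k.
have hV (V : 'M[F]_n.+1) : uni_trig V^T -> unit_hessenberg (V *m C).
  case=> tV dV i j lt_ji; rewrite CE.
  have lt_j : (j.+1 < n.+1)%N by apply: leq_ltn_trans lt_ji (ltn_ord i).
  have Ej : ordS j = j.+1 :> nat by rewrite /= modn_small.
  case: (eqVneq (i : nat) j.+1) => [e|ne].
    by have -> : ordS j = i; [apply: val_inj; rewrite /= modn_small|have := dV i; rewrite mxE].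
  have /is_trig_mxP := tV => /(_ (ordS j) i); rewrite mxE; apply.
  by rewrite Ej ltn_neqAle eq_sym ne.
have uniL : uni_trig L^T^T by rewrite trmxK.
have hess2 (V : 'M[F]_n.+1) : uni_trig V^T -> V \in unitmx -> sym_prod 2 (V *m C).
  by move=> uV iV; apply: hessenberg_sym_prod; [exact: hV|rewrite unitmx_mul iV].
rewrite -[L^T](mulmxK uC); apply: (@SymProdM _ 2 2); first exact: hess2.
apply: sym_prod_inv; rewrite -[C]mul1mx; apply: hess2; last exact: unitmx1.
by rewrite trmx1; apply: uni_trig1.
Qed.

Lemma tr_block_uni (n : nat) (r : 'rV[F]_n) (U : 'M[F]_n) :
  uni_trig U^T -> uni_trig (block_mx (1%:M : 'M_1) r 0 U)^T.
Proof. by move=> uU; rewrite tr_block_mx trmx1 trmx0; apply: uni_trig_block. Qed.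

End FieldMatrices.

(** * Matrices over F_2, carried by [bool] with xor as addition: triangular factorization and
    elementary generators *)

Lemma addmm2 (m n : nat) (A : 'M[bool]_(m, n)) : A + A = 0.
Proof. by apply/matrixP=> i j; rewrite !mxE; case: (A i j). Qed.

Lemma addmK2 (m n : nat) (A B : 'M[bool]_(m, n)) : A + B + B = A.
Proof. by rewrite -addrA addmm2 addr0. Qed.

Lemma addmm2_eq (m n : nat) (A B : 'M[bool]_(m, n)) : A + B = 0 -> A = B.
Proof. by move=> h; rewrite -[A](addmK2 _ B) h add0r. Qed.

(** Elimination without permutations: when the corner is 0, adding a lower row makes it 1, which is
    the source of the extra upper factor V. The Schur complement is then treated by induction. *)
Lemma unitmx_VLU (n : nat) (A : 'M[bool]_n) :
  A \in unitmx ->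
  exists V L U : 'M[bool]_n,
    [/\ uni_trig V^T, uni_trig L, uni_trig U^T & A = V *m L *m U].
Proof.
elim: n A => [|n IH] A uA.
  exists 1%:M, 1%:M, 1%:M; rewrite trmx1; split; try exact: uni_trig1.
  by apply/matrixP=> -[].
rewrite -[n.+1]/(1 + n)%N in A uA *.
pose c := dlsubmx A; pose E := drsubmx A.
have [r hr] : exists r, ulsubmx A + r *m c = 1%:M.
  case h1 : (ulsubmx A 0 0).
    by exists 0; rewrite mul0mx addr0 [LHS]mx11_scalar h1.
  have [i ci] : exists i, c i 0.
    apply/existsP; apply: contraT; rewrite negb_exists => /forallP c0.
    have : A *m col_mx 1%:M 0 = 0.
      rewrite -[A]submxK mul_block_col !mulmx0 !mulmx1 !addr0 -/c.
      rewrite [ulsubmx A]mx11_scalar h1 (_ : c = 0) ?raddf0 ?col_mx0 //.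
      by apply/matrixP=> i j; rewrite ord1 [RHS]mxE; apply/negbTE/c0.
    move/(congr1 (mulmx (invmx A))); rewrite mulKmx // mulmx0.
    move/matrixP/(_ (lshift n (0 : 'I_1)) 0).
    by rewrite (@col_mxEu _ 1 n 1) !mxE.
  exists (delta_mx 0 i); rewrite -rowE [ulsubmx A]mx11_scalar h1 raddf0 add0r.
  by rewrite [LHS]mx11_scalar mxE ci.
pose b := ursubmx A + r *m E; pose A2 := E + c *m b.
have hA : A = block_mx 1%:M r 0 1%:M *m block_mx 1%:M 0 c 1%:M *m
              block_mx 1%:M 0 0 A2 *m block_mx 1%:M b 0 1%:M.
  rewrite !mulmx_block !(mul1mx, mulmx1, mul0mx, mulmx0, addr0, add0r).
  rewrite -[LHS]submxK -/c -/E /A2; congr block_mx.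
  - by rewrite -hr addmK2.
  - rewrite mulmxDl mul1mx [r *m (E + _)]mulmxDr [r *m (c *m b)]mulmxA.
    by rewrite [r *m E + _]addrC addrA addmK2 addmK2.
  - by rewrite addrCA addmm2 addr0.
have : A \in unitmx by [].
rewrite hA !unitmx_mul block_diag_mx_unit => /andP[/andP[_ /andP[_ uA2]] _].
have [V [L [U [uV uL uU eA2]]]] := IH _ uA2.
have iV : V \in unitmx by rewrite -unitmx_tr uni_trig_unit.
(* The factor V of the Schur complement is pulled to the left past the column [c], which becomes
   [invmx V *m c]. *)
exists (block_mx 1%:M (r *m V) 0 V), (block_mx 1%:M 0 (invmx V *m c) L).
exists (block_mx 1%:M b 0 U).
split; [exact: tr_block_uni|exact: uni_trig_block|exact: tr_block_uni|].
rewrite eA2.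
rewrite !mulmx_block !(mul1mx, mulmx1, mul0mx, mulmx0, addr0, add0r).
by rewrite -!mulmxA !mulKVmx.
Qed.

(** The generators 1 + E_ij describe CNOT gates on bit vectors, so membership gives a Clifford
    circuit for the linear map. *)
Inductive elem_gen (n : nat) : 'M[bool]_n -> Prop :=
| ElemGen1 : elem_gen 1%:M
| ElemGenM i j A :
    i != j -> elem_gen A -> elem_gen ((1%:M + delta_mx i j) *m A).

Lemma elem_gen_mul (n : nat) (A B : 'M[bool]_n) :
  elem_gen A -> elem_gen B -> elem_gen (A *m B).
Proof.
move=> gA gB; elim: gA => [|i j A1 ne_ij _ IH]; first by rewrite mul1mx.
by rewrite -mulmxA; apply: ElemGenM.
Qed.

Lemma elem_gen_delta (n : nat) (i j : 'I_n) :
  i != j -> elem_gen (1%:M + delta_mx i j).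
Proof. by move=> ne; rewrite -[_ + _]mulmx1; apply: ElemGenM ne (ElemGen1 n). Qed.

Lemma elem_gen_tr (n : nat) (A : 'M[bool]_n) : elem_gen A -> elem_gen A^T.
Proof.
elim=> [|i j A1 ne_ij _ IH]; first by rewrite trmx1; apply: ElemGen1.
rewrite trmx_mul; apply: elem_gen_mul => //.
by rewrite linearD /= trmx1 trmx_delta; apply: elem_gen_delta; rewrite eq_sym.
Qed.

Lemma elem_gen_block (n : nat) (A : 'M[bool]_n) :
  elem_gen A -> elem_gen (block_mx (1%:M : 'M_1) 0 0 A).
Proof.
elim=> [|i j A1 ne_ij _ IH]; first by rewrite -scalar_mx_block; apply: ElemGen1.
have -> : block_mx 1%:M 0 0 ((1%:M + delta_mx i j) *m A1) =
    (1%:M + delta_mx (rshift 1 i) (rshift 1 j)) *m block_mx (1%:M : 'M_1) 0 0 A1.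
  have -> : delta_mx (rshift 1 i) (rshift 1 j) =
      block_mx (0 : 'M[bool]_1) 0 0 (delta_mx i j).
    by rewrite delta_mx_dshift delta_mx_rshift /block_mx row_mx0.
  rewrite scalar_mx_block add_block_mx mulmx_block.
  by rewrite !(mul1mx, mulmx1, mul0mx, mulmx0, addr0, add0r).
by apply: ElemGenM IH; rewrite (inj_eq (@rshift_inj _ _)).
Qed.

(** Such block matrices multiply by adding their columns, so the column splits into unit columns,
    each a single generator. *)
Lemma elem_gen_col (n : nat) (c : 'cV[bool]_n) :
  elem_gen (block_mx (1%:M : 'M_1) 0 c 1%:M).
Proof.
rewrite [c]matrix_sum_delta.
apply: (big_ind (fun c => elem_gen (block_mx (1%:M : 'M_1) 0 c 1%:M))).
- by rewrite -scalar_mx_block; apply: ElemGen1.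
- move=> c1 c2 g1 g2; have := elem_gen_mul g1 g2; rewrite mulmx_block.
  by rewrite !(mul1mx, mulmx1, mul0mx, mulmx0, addr0, add0r).
move=> i _; rewrite big_ord1; case: (c i 0); last first.
  by rewrite scale0r -scalar_mx_block; apply: ElemGen1.
rewrite scale1r.
have -> : block_mx 1%:M 0 (delta_mx i 0) 1%:M =
    1%:M + delta_mx (rshift 1 i) (lshift n (0 : 'I_1)) :> 'M[bool]_(1 + n).
  have -> : delta_mx (rshift 1 i) (lshift n (0 : 'I_1)) =
      block_mx (0 : 'M[bool]_1) 0 (delta_mx i 0) 0.
    by rewrite delta_mx_dshift delta_mx_lshift /block_mx row_mx0.
  by rewrite scalar_mx_block add_block_mx !(addr0, add0r).
by apply: elem_gen_delta; rewrite eq_sym eq_lrshift.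
Qed.

Lemma elem_gen_uni_trig (n : nat) (L : 'M[bool]_n) : uni_trig L -> elem_gen L.
Proof.
case=> tL; elim/trigsqmx_ind: tL => [|n0 x c A _ IH] dA.
  by rewrite (_ : 0 = 1%:M); [apply: ElemGen1|apply/matrixP=> -[]].
have -> : x = 1%:M.
  by rewrite [x]mx11_scalar; have := dA (lshift n0 0); rewrite block_mxEul => ->.
have -> : block_mx 1%:M 0 c A = block_mx (1%:M : 'M_1) 0 c 1%:M *m block_mx 1%:M 0 0 A.
  by rewrite mulmx_block !(mul1mx, mulmx1, mul0mx, mulmx0, addr0, add0r).
apply: elem_gen_mul; first exact: elem_gen_col.
by apply/elem_gen_block/IH => i; have := dA (rshift 1 i); rewrite block_mxEdr.
Qed.

Lemma elem_gen_unit (n : nat) (A : 'M[bool]_n) : A \in unitmx -> elem_gen A.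
Proof.
case/unitmx_VLU=> V [L [U [uV uL uU ->]]].
apply: elem_gen_mul; first apply: elem_gen_mul; last 1 first.
- by rewrite -[U]trmxK; apply/elem_gen_tr/elem_gen_uni_trig.
- by rewrite -[V]trmxK; apply/elem_gen_tr/elem_gen_uni_trig.
exact: elem_gen_uni_trig.
Qed.

Lemma unitmx_sym_prod (n : nat) (A : 'M[bool]_n) :
  A \in unitmx -> sym_prod 12 A.
Proof.
case/unitmx_VLU=> V [L [U [uV uL uU ->]]].
apply: (@SymProdM _ _ 8 4); first apply: (@SymProdM _ _ 4 4).
- by rewrite -[V]trmxK; apply/sym_prod_tr/uni_trig_sym_prod.
- exact: uni_trig_sym_prod.
- by rewrite -[U]trmxK; apply/sym_prod_tr/uni_trig_sym_prod.
Qed.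

(* The decomposition is due to Aaronson and Gottesman. *)
Lemma sym_gram_diag (n : nat) (X : 'M[bool]_n) :
  X^T = X -> exists (M : 'M[bool]_n) (d : 'rV[bool]_n),
    uni_trig M /\ X = M *m M^T + diag_mx d.
Proof.
elim: n X => [|n IH] X sX.
  by exists 1%:M, 0; split; [exact: uni_trig1|apply/matrixP=> -[]].
rewrite -[n.+1]/(1 + n)%N in X sX *.
pose b := ursubmx X.
have db : dlsubmx X = b^T by rewrite /b trmx_ursub sX.
have [|M [d [uM hM]]] := IH (drsubmx X + b^T *m b).
  by rewrite linearD /= trmx_drsub sX trmx_mul trmxK.
(* The corner of M M^T is 1, so the diagonal part takes the corner of X plus 1. *)
exists (block_mx 1%:M 0 b^T M), (row_mx (ulsubmx X + 1%:M) d).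
split; first exact: uni_trig_block.
rewrite diag_mx_row tr_block_mx mulmx_block trmx1 trmx0 trmxK.
rewrite !(mul1mx, mulmx1, mul0mx, mulmx0, addr0, add0r) add_block_mx !addr0.
rewrite -addrA -hM -[LHS]submxK -/b db; congr block_mx.
  by apply/matrixP=> i j; rewrite !ord1 !mxE; case: (X _ _).
by rewrite addrCA addmm2 addr0.
Qed.

(* The symplectic group over F_2, in the row convention: [v] is sent to
   [v *m M] and [v = row_mx a b] encodes the Pauli operator X^a Z^b. *)
Definition Omega (n : nat) : 'M[bool]_(n + n) := block_mx 0 1%:M 1%:M 0.
Definition symp_u (n : nat) (X : 'M[bool]_n) : 'M_(n + n) :=
  block_mx 1%:M X 0 1%:M.
Definition symp_l (n : nat) (X : 'M[bool]_n) : 'M_(n + n) :=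
  block_mx 1%:M 0 X 1%:M.
Definition symp_d (n : nat) (A : 'M[bool]_n) : 'M_(n + n) :=
  block_mx A 0 0 (invmx A)^T.
Definition symplectic (n : nat) (M : 'M[bool]_(n + n)) : Prop :=
  M *m Omega n *m M^T = Omega n.

Local Definition simpmx := (mul1mx, mulmx1, mul0mx, mulmx0, addr0, add0r).

Lemma symp_uD (n : nat) (X Y : 'M[bool]_n) :
  symp_u (X + Y) = symp_u X *m symp_u Y.
Proof. by rewrite mulmx_block !simpmx addrC. Qed.

Lemma Omega_lu (n : nat) (X : 'M[bool]_n) :
  symp_l X = Omega n *m symp_u X *m Omega n.
Proof. by rewrite !mulmx_block !simpmx. Qed.

Lemma symp_du (n : nat) (A X : 'M[bool]_n) : A \in unitmx ->
  symp_u (A *m X *m A^T) = symp_d A *m symp_u X *m symp_d (invmx A).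
Proof.
move=> uA; rewrite !mulmx_block !simpmx mulmxV // invmxK.
by rewrite -trmx_mul mulmxV // trmx1.
Qed.

Lemma symp_dM (n : nat) (A B : 'M[bool]_n) : A \in unitmx -> B \in unitmx ->
  symp_d (A *m B) = symp_d A *m symp_d B.
Proof.
by move=> uA uB; rewrite mulmx_block !simpmx /symp_d -trmx_mul invmx_mul.
Qed.

(** The SL_2 identity u(a) l(1/a) u(a) = antidiagonal (a, 1/a), with matrix entries in
    characteristic 2. Symmetry of A identifies the lower block of [symp_d A] with A^-1. *)
Lemma symp_d_sym (n : nat) (A : 'M[bool]_n) : A^T = A -> A \in unitmx ->
  symp_d A = symp_u A *m symp_l (invmx A) *m symp_u A *m Omega n.
Proof.
move=> sA uA; rewrite !mulmx_block !simpmx mulmxV // mulVmx //.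
by rewrite !addmm2 !simpmx /symp_d trmx_inv sA.
Qed.

Lemma Omega_lul (n : nat) :
  Omega n = symp_u 1%:M *m symp_l 1%:M *m symp_u 1%:M.
Proof. by rewrite !mulmx_block !simpmx !addmm2 !simpmx. Qed.

(** Bring A to its rank normal form I and take for Z the complementary idempotent J, transported
    back. If w (I + B' J) = 0, then w I = 0, and the symmetry of I B'^T gives w B' I = w I B'^T = 0,
    so w B' = 0 too. Such a w annihilates both blocks of the row (A, B), against the second
    hypothesis. *)
Lemma sym_completion (n : nat) (A B C D : 'M[bool]_n) :
  A *m B^T = B *m A^T -> A *m D^T + B *m C^T = 1%:M ->
  exists2 Z : 'M[bool]_n, Z^T = Z & A + B *m Z \in unitmx.
Proof.
move=> sAB hAD.
pose P := col_ebase A; pose Q := row_ebase A.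
have uP : P \in unitmx := col_ebase_unit A.
have uQ : Q \in unitmx := row_ebase_unit A.
have le_r : (\rank A <= n)%N := rank_leq_row A.
pose I := pid_mx (\rank A) : 'M[bool]_n; pose J := copid_mx (\rank A) : 'M[bool]_n.
have hA : P *m I *m Q = A := mulmx_ebase A.
pose B' := invmx P *m B *m Q^T.
have hB : B = P *m B' *m invmx Q^T.
  by rewrite /B' !mulmxA mulmxV // mul1mx mulmxK // unitmx_tr.
have sB' : I *m B'^T = B' *m I.
  have -> : I *m B'^T = invmx P *m (A *m B^T) *m (invmx P)^T.
    by rewrite -hA /B' !trmx_mul trmxK !mulmxA mulVmx // mul1mx.
  rewrite sAB -{1}hA !trmx_mul tr_pid_mx -!mulmxA -[P^T *m _]trmx_mul mulVmx //.
  by rewrite trmx1 mulmx1 /B' !mulmxA.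
clearbody B'.
have IJ : I + J = 1%:M by rewrite addrC subrK.
exists (Q^T *m J *m Q).
  rewrite !trmx_mul trmxK mulmxA /J /copid_mx [X in _ *m X *m _]linearB /=.
  by rewrite trmx1 tr_pid_mx.
rewrite -{1}hA hB.
have -> : P *m I *m Q + P *m B' *m invmx Q^T *m (Q^T *m J *m Q) =
    P *m (I + B' *m J) *m Q.
  by rewrite [in RHS](mulmxDr P I) (mulmxDl (P *m I) _ Q) !mulmxA mulmxKV // unitmx_tr.
rewrite !unitmx_mul uP uQ andbT /= -row_free_unit -kermx_eq0.
apply/eqP/row_matrixP => i; rewrite row0.
set w := row i _.
have hw : w *m (I + B' *m J) = 0.
  by apply/sub_kermxP; apply: row_sub.
have wI : w *m I = 0.
  move: hw => /(congr1 (mulmxr I)); rewrite /= mul0mx (mulmxDr w I) (mulmxDl (w *m I)) -!mulmxA.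
  by rewrite [I *m I]pid_mx_id // [J *m I]mul_copid_mx_pid // !mulmx0 addr0.
have wBJ : w *m B' *m J = 0 by move: hw; rewrite (mulmxDr w I) wI add0r mulmxA.
have wB : w *m B' = 0.
  rewrite -[LHS]mulmx1 -IJ (mulmxDr _ I) wBJ addr0 -mulmxA -sB' mulmxA wI.
  by rewrite mul0mx.
have : w *m invmx P *m (A *m D^T + B *m C^T) = 0.
  rewrite (mulmxDr _ (A *m _)) -hA hB !mulmxA !mulmxKV // wI wB.
  by rewrite !mul0mx addr0.
rewrite hAD mulmx1 => /(congr1 (mulmxr P)).
by rewrite /= mul0mx mulmxKV.
Qed.

Lemma symplectic_mul (n : nat) (M N : 'M[bool]_(n + n)) :
  symplectic M -> symplectic N -> symplectic (M *m N).
Proof.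
rewrite /symplectic => hM hN.
by rewrite trmx_mul !mulmxA -[M *m N *m _]mulmxA -[M *m _ *m N^T]mulmxA hN.
Qed.

Lemma symplectic_l (n : nat) (X : 'M[bool]_n) : X^T = X -> symplectic (symp_l X).
Proof.
move=> sX; rewrite /symplectic tr_block_mx !mulmx_block !trmx1 trmx0 sX !simpmx.
by rewrite addmm2.
Qed.

(** Multiplying by a suitable l(Z) makes the upper left block invertible; block elimination then
    applies, and the symplectic relations force its two off-diagonal factors to be symmetric. l(Z)
    is its own inverse. *)
Lemma symplectic_decomp (n : nat) (M : 'M[bool]_(n + n)) :
  symplectic M ->
  exists A X Y Z : 'M[bool]_n,
    [/\ A \in unitmx, X^T = X, Y^T = Y, Z^T = Z &
     M = symp_l X *m symp_d A *m symp_u Y *m symp_l Z].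
Proof.
move=> sM.
have eqs (N : 'M[bool]_(n + n)) : symplectic N ->
    [/\ ulsubmx N *m (ursubmx N)^T = ursubmx N *m (ulsubmx N)^T,
        ulsubmx N *m (drsubmx N)^T + ursubmx N *m (dlsubmx N)^T = 1%:M &
        dlsubmx N *m (drsubmx N)^T = drsubmx N *m (dlsubmx N)^T].
  rewrite /symplectic -{1 2}[N]submxK tr_block_mx !mulmx_block !simpmx.
  case/eq_block_mx=> e1 e2 _ e4; split; last 2 first.
  - by rewrite addrC.
  - by symmetry; apply: addmm2_eq.
  - by symmetry; apply: addmm2_eq.
have [e1 e2 _] := eqs _ sM.
have [Z sZ uZ] := sym_completion e1 e2.
have sN : symplectic (M *m symp_l Z) := symplectic_mul sM (symplectic_l sZ).
have ulN : ulsubmx (M *m symp_l Z) \in unitmx.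
  by rewrite -[M]submxK mulmx_block block_mxKul mulmx1.
have {e1 e2 eqs} := eqs _ sN.
move eN : (M *m symp_l Z) sN ulN => N sN uA [].
set A := ulsubmx N in uA *; set B := ursubmx N; set C := dlsubmx N.
set D := drsubmx N => e1 e2 e3.
have uAT : A^T \in unitmx by rewrite unitmx_tr.
have sAB : A *m (invmx A *m B)^T = B.
  by rewrite trmx_mul mulmxA e1 trmx_inv mulmxK.
have CX : C = C *m invmx A *m A by rewrite mulmxKV.
(* D is determined by the transpose of [e2], D A^T + C B^T = 1, together with B A^T = A B^T. *)
have eD : D = (invmx A)^T + C *m invmx A *m B.
  apply: (can_inj (mulmxK uAT)); rewrite mulmxDl -[_ *m B *m A^T]mulmxA -e1 trmx_inv mulVmx //.
  rewrite mulmxA -CX -trmx1 -e2 linearD /= !trmx_mul !trmxK.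
  by rewrite addmK2.
exists A, (C *m invmx A), (invmx A *m B), Z; split=> //.
- have sX (X : 'M[bool]_n) : C = X *m A -> D = (invmx A)^T + X *m B -> X^T = X.
    move=> hC hD; move: e3; rewrite hC hD linearD /= trmxK !trmx_mul.
    rewrite mulmxDr mulmxDl mulmxK // trmx_inv mulKmx // -!mulmxA.
    by rewrite [A *m _]mulmxA [B *m _]mulmxA e1 => /addIr.
  exact: sX.
- by apply: (can_inj (mulKmx uA)); rewrite sAB mulKVmx.
have -> : M = N *m symp_l Z.
  by rewrite -eN -mulmxA mulmx_block !simpmx addmm2 -scalar_mx_block mulmx1.
congr (_ *m _); rewrite !mulmx_block !simpmx mulKVmx //.
by rewrite -CX [C *m _]mulmxA addrC -eD submxK.
Qed.

(** * Operators indexed by bit vectors *)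

Section Operators.
Variable R : realType.
Implicit Types m n : nat.

(** Basis states are relabelled by row vectors over F_2, so that gates can be described by linear
    algebra on labels. *)
Definition vec n (i : 'I_(qdim n)) : 'rV[bool]_n := \row_q tnth (bits i) q.
Definition idx n (v : 'rV[bool]_n) : 'I_(qdim n) :=
  enum_rank [tuple v 0 q | q < n].

Lemma vecK n : cancel (@vec n) (@idx n).
Proof.
move=> i; rewrite /idx -[RHS]enum_valK; congr enum_rank.
by apply: eq_from_tnth => q; rewrite tnth_mktuple mxE.
Qed.

Lemma idxK n : cancel (@idx n) (@vec n).
Proof. by move=> v; apply/rowP=> q; rewrite mxE /bits enum_rankK tnth_mktuple. Qed.

Definition opv n (f : 'rV[bool]_n -> 'rV[bool]_n -> R[i]) : 'M[R[i]]_(qdim n) :=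
  \matrix_(i, j) f (vec i) (vec j).

Definition ent n (A : 'M[R[i]]_(qdim n)) (x y : 'rV[bool]_n) : R[i] :=
  A (idx x) (idx y).

Lemma ent_opv n f x y : ent (@opv n f) x y = f x y.
Proof. by rewrite /ent mxE !idxK. Qed.

Lemma ent_inj n (A B : 'M[R[i]]_(qdim n)) :
  (forall x y, ent A x y = ent B x y) -> A = B.
Proof.
by move=> h; apply/matrixP=> i j; have := h (vec i) (vec j); rewrite /ent !vecK.
Qed.

Lemma ent_mul n (A B : 'M[R[i]]_(qdim n)) x z :
  ent (A *m B) x z = \sum_y ent A x y * ent B y z.
Proof.
rewrite /ent mxE (reindex (@vec n)) /=; last by exists (@idx n) => ? _; rewrite ?vecK ?idxK.
by apply: eq_bigr => k _; rewrite vecK.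
Qed.

Lemma ent1 n x y : ent (1%:M : 'M[R[i]]_(qdim n)) x y = (x == y)%:R.
Proof. by rewrite /ent mxE (can_eq (@idxK n)). Qed.

Lemma entD n (A B : 'M[R[i]]_(qdim n)) x y : ent (A + B) x y = ent A x y + ent B x y.
Proof. by rewrite /ent mxE. Qed.

Lemma entN n (A : 'M[R[i]]_(qdim n)) x y : ent (- A) x y = - ent A x y.
Proof. by rewrite /ent mxE. Qed.

Lemma entZ n a (A : 'M[R[i]]_(qdim n)) x y : ent (a *: A) x y = a * ent A x y.
Proof. by rewrite /ent mxE. Qed.

(** The operator |y> -> phi(y) |s(y)>. Every gate except H has this form, so most operator
    identities reduce to identities of functions on bit vectors. *)
Definition mono n (s : 'rV[bool]_n -> 'rV[bool]_n) (phi : 'rV[bool]_n -> R[i]) :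
    'M[R[i]]_(qdim n) :=
  opv (fun x y => if x == s y then phi y else 0).

Lemma ent_mono n s phi x y :
  ent (@mono n s phi) x y = if x == s y then phi y else 0.
Proof. exact: ent_opv. Qed.

Lemma eq_mono n s t phi psi :
  s =1 t -> phi =1 psi -> @mono n s phi = @mono n t psi.
Proof. by move=> e1 e2; apply: ent_inj => x y; rewrite !ent_mono e1 e2. Qed.

Lemma mono1 n : @mono n id (fun=> 1) = 1%:M.
Proof. by apply: ent_inj => x y; rewrite ent_mono ent1; case: eqP. Qed.

Lemma ent_mul_mono n (A : 'M[R[i]]_(qdim n)) s phi x z :
  ent (A *m mono s phi) x z = ent A x (s z) * phi z.
Proof.
rewrite ent_mul (bigD1 (s z)) //= ent_mono eqxx big1 ?addr0 // => y ne.
by rewrite ent_mono (negPf ne) mulr0.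
Qed.

Lemma ent_diag_mul n (A : 'M[R[i]]_(qdim n)) phi x z :
  ent (mono id phi *m A) x z = phi x * ent A x z.
Proof.
rewrite ent_mul (bigD1 x) //= ent_mono eqxx big1 ?addr0 // => y ne.
by rewrite ent_mono eq_sym (negPf ne) mul0r.
Qed.

Lemma monoM n s t phi psi :
  @mono n s phi *m mono t psi = mono (s \o t) (fun y => phi (t y) * psi y).
Proof.
apply: ent_inj => x y; rewrite ent_mul_mono !ent_mono /=.
by case: eqP; rewrite ?mul0r.
Qed.

Lemma monoZ n a s phi : a *: @mono n s phi = mono s (fun y => a * phi y).
Proof. by apply: ent_inj => x y; rewrite entZ !ent_mono; case: eqP; rewrite ?mulr0. Qed.

(** * Operators acting on the qubits in the image of an injection *)

Section Embedding.
Variables (m n : nat) (iota : 'I_m -> 'I_n).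
Hypothesis iota_inj : injective iota.
Implicit Types (x y z : 'rV[bool]_n) (u : 'rV[bool]_m) (A B : 'M[R[i]]_(qdim m)).

Definition agree (x y : 'rV[bool]_n) : bool :=
  [forall r, (r \notin codom iota) ==> (x 0 r == y 0 r)].

Lemma agreeP x y :
  reflect (forall r, r \notin codom iota -> x 0 r = y 0 r) (agree x y).
Proof.
apply: (iffP forallP) => [h r hr|h r]; first exact/eqP/(implyP (h r)).
by apply/implyP=> hr; apply/eqP/h.
Qed.

Definition res (x : 'rV[bool]_n) : 'rV[bool]_m := \row_q x 0 (iota q).

Definition put (u : 'rV[bool]_m) (x : 'rV[bool]_n) : 'rV[bool]_n :=
  \row_r (if [pick q | iota q == r] is Some q then u 0 q else x 0 r).

Lemma put_in u x q : put u x 0 (iota q) = u 0 q.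
Proof.
rewrite mxE; case: pickP => [q' /eqP/iota_inj-> //|/(_ q)].
by rewrite eqxx.
Qed.

Lemma put_out u x r : r \notin codom iota -> put u x 0 r = x 0 r.
Proof.
by move=> hr; rewrite mxE; case: pickP => // q /eqP e; rewrite -e codom_f in hr.
Qed.

Lemma resK u x : res (put u x) = u.
Proof. by apply/rowP=> q; rewrite mxE put_in. Qed.

Lemma eq_off (x y : 'rV[bool]_n) : (x == y) = agree x y && (res x == res y).
Proof.
apply/eqP/andP=> [->|[/agreeP h1 /eqP h2]]; first by split=> //; apply/agreeP.
apply/rowP=> r; case: (boolP (r \in codom iota)) => [/codomP[q ->]|/h1//].
by move/rowP/(_ q): h2; rewrite !mxE.
Qed.

Lemma eq_put x u y : (x == put u y) = agree x y && (res x == u).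
Proof.
rewrite eq_off resK; congr (_ && _).
by apply/agreeP/agreeP=> h r hr; rewrite h ?put_out.
Qed.

Definition emb (A : 'M[R[i]]_(qdim m)) : 'M[R[i]]_(qdim n) :=
  opv (fun x y => if agree x y then ent A (res x) (res y) else 0).

Lemma ent_emb A x y :
  ent (emb A) x y = if agree x y then ent A (res x) (res y) else 0.
Proof. exact: ent_opv. Qed.

Lemma emb_mono s phi :
  emb (mono s phi) = mono (fun y => put (s (res y)) y) (phi \o res).
Proof.
by apply: ent_inj => x y; rewrite ent_emb !ent_mono eq_put; case: agree.
Qed.

Lemma emb1 : emb 1%:M = 1%:M.
Proof.
apply: ent_inj => x y; rewrite ent_emb !ent1 [in RHS]eq_off.
by case: agree.
Qed.

Lemma emb_mul A B : emb (A *m B) = emb A *m emb B.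
Proof.
apply: ent_inj => x z; rewrite ent_mul ent_emb.
rewrite (bigID (agree x)) /= [X in _ = _ + X]big1 ?addr0; last first.
  by move=> y /negbTE h; rewrite ent_emb h mul0r.
(* The intermediate states that agree with x off the image are exactly the [put u x]. *)
rewrite (reindex_onto (fun u => put u x) res) /=; last first.
  move=> y hy; apply/esym/eqP; rewrite eq_put eqxx andbT.
  by apply/agreeP=> r /(agreeP _ _ hy).
have hput u : agree x (put u x) by apply/agreeP=> r hr; rewrite put_out.
have hput' u : agree (put u x) z = agree x z.
  by apply/agreeP/agreeP=> h r hr; rewrite -h // put_out.
case: ifP => hxz; last first.
  by rewrite big1 // => u _; rewrite !ent_emb hput' hxz mulr0.
rewrite ent_mul; apply: eq_big => u; first by rewrite hput resK eqxx.
by rewrite !ent_emb hput hput' hxz !resK.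
Qed.

End Embedding.

Lemma on_qubitE n (q : 'I_n) (G : 'M[R[i]]_2) :
  on_qubit q G = opv (fun x y =>
    if [forall r, (r != q) ==> (x 0 r == y 0 r)]
    then entry G (x 0 q) (y 0 q) else 0).
Proof.
apply/matrixP=> i j; rewrite !mxE.
by congr (if _ then _ else _); apply: eq_forallb => r; rewrite !mxE.
Qed.

Lemma ent_on_qubit n (q : 'I_n) (G : 'M[R[i]]_2) x y :
  ent (on_qubit q G) x y =
    if [forall r, (r != q) ==> (x 0 r == y 0 r)]
    then entry G (x 0 q) (y 0 q) else 0.
Proof. by rewrite on_qubitE ent_opv. Qed.

Lemma emb_on_qubit m n (f : 'I_m -> 'I_n) q (G : 'M[R[i]]_2) :
  injective f -> emb f (on_qubit q G) = on_qubit (f q) G.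
Proof.
move=> f_inj; apply: ent_inj => x y; rewrite ent_emb !ent_on_qubit !mxE.
suff -> : [forall r, (r != f q) ==> (x 0 r == y 0 r)] =
    agree f x y && [forall r, (r != q) ==> (res f x 0 r == res f y 0 r)].
  by case: agree.
apply/forallP/andP=> [h|[/agreeP h1 /forallP h2] r].
  split; first apply/agreeP=> r hr.
    apply/eqP/(implyP (h r)); apply: contra hr => /eqP->; exact: codom_f.
  by apply/forallP=> r; rewrite !mxE; have := h (f r); rewrite (inj_eq f_inj).
apply/implyP=> hr; case: (boolP (r \in codom f)) => [/codomP[l e]|/h1->//].
have := h2 l; rewrite !mxE -e => /implyP; apply.
by apply: contra hr => /eqP <-; rewrite e.
Qed.

Lemma cnot_mxE n (c t : 'I_n) :
  cnot_mx R c t =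
  mono (fun y => \row_r (y 0 r + ((r == t) && y 0 c))) (fun=> 1).
Proof.
apply/matrixP=> i j; rewrite [LHS]mxE [RHS]mxE.
set z := [tuple _ | r < n].
suff -> : (bits i == z) = (vec i == \row_r (vec j 0 r + ((r == t) && vec j 0 c))).
  by case: eqP.
apply/eqP/eqP=> [e|/rowP e].
  by apply/rowP=> r; rewrite !mxE e tnth_mktuple.
apply: eq_from_tnth => r; have := e r; rewrite !mxE => ->.
by rewrite tnth_mktuple.
Qed.

Lemma emb_cnot m n (f : 'I_m -> 'I_n) c t :
  injective f -> emb f (cnot_mx R c t) = cnot_mx R (f c) (f t).
Proof.
move=> f_inj; rewrite !cnot_mxE emb_mono //; apply: eq_mono => // y.
apply/rowP=> r; case: (boolP (r \in codom f)) => [/codomP[q ->]|hr].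
  by rewrite put_in // !mxE (inj_eq f_inj).
rewrite put_out // mxE; case: eqP => [e|_]; last by rewrite addr0.
by rewrite e codom_f in hr.
Qed.

Lemma phase_gateE n (q : 'I_n) (a : R[i]) :
  on_qubit q (phase_mx a) = mono id (fun y => if y 0 q then a else 1).
Proof.
apply: ent_inj => x y; rewrite ent_on_qubit ent_mono.
have -> : (x == y) = [forall r, (r != q) ==> (x 0 r == y 0 r)] && (x 0 q == y 0 q).
  apply/eqP/andP=> [->|[/forallP h /eqP e]].
    by split=> //; apply/forallP=> r; rewrite eqxx implybT.
  apply/rowP=> r; case: (eqVneq r q) => [->//|ne].
  by have := h r; rewrite ne => /eqP.
case: ifP => //= _; rewrite /entry !mxE.
case: (x 0 q) (y 0 q) => [] [] //=; rewrite -?val_eqE /= !inordK //=.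
Qed.

(** * Controlled operators: products, conjugation, restriction to fewer qubits *)

Lemma controlled_mx_ent n (U : 'M[R[i]]_(qdim n)) x y :
  ent (controlled_mx U) x y =
  if x 0 0 == y 0 0 then
    (if x 0 0 then ent U (res (lift ord0) x) (res (lift ord0) y)
     else (res (lift ord0) x == res (lift ord0) y)%:R)
  else 0.
Proof.
rewrite /ent mxE.
have hd (z : 'rV[bool]_n.+1) : thead (bits (idx z)) = z 0 0.
  by rewrite /thead -{2}[z]idxK mxE.
have tl (z : 'rV[bool]_n.+1) :
    enum_rank (btail (bits (idx z))) = idx (res (lift ord0) z).
  congr enum_rank; apply: eq_from_tnth => r.
  rewrite tnth_mktuple mxE -{2}[z]idxK mxE tnth_behead; congr tnth.
  by apply: val_inj; rewrite /= inordK // ltnS.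
rewrite !hd !tl; case: eqP => // _; case: (x 0 0) => //.
by rewrite mxE (can_eq (@idxK n)).
Qed.

Definition proj1 n : 'M[R[i]]_(qdim n.+1) := mono id (fun y => (y 0 0)%:R).

Lemma proj1_idem n : proj1 n *m proj1 n = proj1 n.
Proof.
rewrite monoM; apply: eq_mono => // y /=.
by case: (y 0 0); rewrite ?mulr1 ?mulr0.
Qed.

Local Notation lft A := (emb (lift ord0) A).

Lemma agree_lift n (x y : 'rV[bool]_n.+1) :
  agree (lift ord0) x y = (x 0 0 == y 0 0).
Proof.
apply/agreeP/eqP=> [h|e r hr].
  by apply: h; apply/codomP=> -[q /eqP]; rewrite (negPf (neq_lift _ _)).
case: (unliftP 0 r) hr => [q ->|-> //]; by rewrite codom_f.
Qed.

Lemma proj1_lft n (A : 'M[R[i]]_(qdim n)) :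
  proj1 n *m lft A = lft A *m proj1 n.
Proof.
apply: ent_inj => x y; rewrite ent_diag_mul ent_mul_mono ent_emb agree_lift.
by case: eqP => [->|]; rewrite ?mulr0 ?mul0r // mulrC.
Qed.

(** In this form, multiplicativity and conjugation only use that [proj1] is idempotent and commutes
    with operators on the last n qubits. *)
Lemma controlled_mx_decomp n (U : 'M[R[i]]_(qdim n)) :
  controlled_mx U = 1%:M + proj1 n *m (lft U - 1%:M).
Proof.
apply: ent_inj => x y; rewrite controlled_mx_ent entD ent_diag_mul entD entN ent_emb.
rewrite !ent1 (eq_off (lift ord0)) agree_lift.
case: eqP => _ /=; last by rewrite subr0 mulr0 addr0.
case: (x 0 0); last by rewrite mul0r addr0.
by rewrite mul1r addrC subrK.
Qed.

Lemma controlled_mul n (U V : 'M[R[i]]_(qdim n)) :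
  controlled_mx (U *m V) = controlled_mx U *m controlled_mx V.
Proof.
have lft_inj := @lift_inj n.+1 ord0.
rewrite !controlled_mx_decomp emb_mul //.
have com := proj1_lft U; have idem := proj1_idem n.
move: (proj1 n) (lft U) (lft V) com idem => P A B com idem.
have PXP : P *m (A - 1%:M) *m P = P *m (A - 1%:M).
  by rewrite mulmxBr mulmx1 mulmxBl idem -mulmxA -com mulmxA idem.
rewrite [RHS]mulmxDl mul1mx mulmxDr mulmx1 (mulmxA _ P) PXP -mulmxA -addrA.
rewrite -!mulmxDr; congr (_ + P *m _).
have -> : (A - 1%:M) + (A - 1%:M) *m (B - 1%:M) = (A - 1%:M) *m B.
  by rewrite -{1}[A - _]mulmx1 -mulmxDr [1%:M + _]addrC subrK.
by rewrite mulmxBl mul1mx [RHS]addrC addrA subrK.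
Qed.

Lemma controlled1 n : controlled_mx (1%:M : 'M[R[i]]_(qdim n)) = 1%:M.
Proof.
by rewrite controlled_mx_decomp emb1 ?subrr ?mulmx0 ?addr0 //; apply: lift_inj.
Qed.

(** When the control is off, the outer factors cancel, so they need no control of their own. This is
    why Clifford conjugation costs no T gates. *)
Lemma controlled_conj n (A B A' : 'M[R[i]]_(qdim n)) :
  A *m A' = 1%:M ->
  controlled_mx (A *m B *m A') = lft A *m controlled_mx B *m lft A'.
Proof.
move=> AA'; have lft_inj := @lift_inj n.+1 ord0.
have eAA : lft A *m lft A' = 1%:M by rewrite -emb_mul // AA' emb1.
have eABA : lft (A *m B *m A') = lft A *m lft B *m lft A' by rewrite !emb_mul.
have com := proj1_lft A.
rewrite !controlled_mx_decomp eABA.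
move: (proj1 n) (lft A) (lft B) (lft A') eAA com => P X Y X' eAA com.
rewrite mulmxDr mulmxDl mulmx1 eAA; congr (_ + _).
have -> : X *m Y *m X' - 1%:M = X *m (Y - 1%:M) *m X'.
  by rewrite mulmxBr mulmxBl mulmx1 eAA.
by rewrite !mulmxA com.
Qed.

Definition lift_emb m n (f : 'I_m -> 'I_n) (q : 'I_m.+1) : 'I_n.+1 :=
  if unlift ord0 q is Some r then lift ord0 (f r) else ord0.

Lemma lift_emb0 m n (f : 'I_m -> 'I_n) : lift_emb f ord0 = ord0.
Proof. by rewrite /lift_emb unlift_none. Qed.

Lemma lift_emb_lift m n (f : 'I_m -> 'I_n) q :
  lift_emb f (lift ord0 q) = lift ord0 (f q).
Proof. by rewrite /lift_emb liftK. Qed.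

Lemma lift_emb_inj m n (f : 'I_m -> 'I_n) :
  injective f -> injective (lift_emb f).
Proof.
move=> f_inj q r; case: (unliftP ord0 q) => [q' ->|->];
  case: (unliftP ord0 r) => [r' ->|->]; rewrite ?lift_emb_lift ?lift_emb0 //.
- by move/lift_inj/f_inj->.
Qed.

(** Makes the cost of controlling an operator depend on the m qubits it touches instead of on n. *)
Lemma controlled_emb m n (f : 'I_m -> 'I_n) (U : 'M[R[i]]_(qdim m)) :
  injective f -> controlled_mx (emb f U) = emb (lift_emb f) (controlled_mx U).
Proof.
move=> f_inj; have g_inj := lift_emb_inj f_inj.
apply: ent_inj => x y; rewrite controlled_mx_ent [RHS]ent_emb controlled_mx_ent.
have h0 z : res (lift_emb f) z 0 0 = z 0 0 by rewrite mxE lift_emb0.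
have h1 z : res (lift ord0) (res (lift_emb f) z) = res f (res (lift ord0) z).
  by apply/rowP=> r; rewrite !mxE lift_emb_lift.
rewrite !h0 !h1 ent_emb [res _ x == _](eq_off f).
case: eqP => e; last by case: agree.
suff -> : agree (lift_emb f) x y = agree f (res (lift ord0) x) (res (lift ord0) y).
  by case: agree; case: (x 0 0).
apply/agreeP/agreeP=> h r hr.
  rewrite !mxE; apply: h; apply: contra hr => /codomP[q].
  case: (unliftP ord0 q) => [q' ->|->]; rewrite ?lift_emb_lift ?lift_emb0.
    by move/lift_inj->; apply: codom_f.
  by move=> /esym/eqP; rewrite (negPf (neq_lift _ _)).
case: (unliftP ord0 r) hr => [q ->|-> //] hr.
have := h q; rewrite !mxE; apply; apply: contra hr => /codomP[l ->].
by rewrite -lift_emb_lift codom_f.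
Qed.

Lemma controlled_scalar n (a : R[i]) :
  controlled_mx (a%:M : 'M_(qdim n)) = mono id (fun y => if y 0 0 then a else 1).
Proof.
apply: ent_inj => x y; rewrite controlled_mx_ent ent_mono (eq_off (lift ord0)).
rewrite agree_lift; case: eqP => //= <-.
have -> : ent (a%:M : 'M_(qdim n)) (res (lift ord0) x) (res (lift ord0) y) =
    if res (lift ord0) x == res (lift ord0) y then a else 0.
  by rewrite /ent mxE (can_eq (@idxK n)); case: eqP.
by case: (x 0 0); case: eqP.
Qed.

Lemma controlled_mono n s phi :
  controlled_mx (@mono n s phi) =
  mono (fun y => if y 0 0 then put (lift ord0) (s (res (lift ord0) y)) y else y)
       (fun y => if y 0 0 then phi (res (lift ord0) y) else 1).
Proof.
have lft_inj := @lift_inj n.+1 ord0.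
apply: ent_inj => x y; rewrite controlled_mx_ent !ent_mono.
case: (boolP (y 0 0)) => hy; last first.
  rewrite (eq_off (lift ord0)) agree_lift (negPf hy); case: (x 0 0) => //=.
  by case: eqP.
by rewrite eq_put // agree_lift hy; case: (x 0 0).
Qed.

End Operators.
Arguments emb {R m n}.
Notation lft A := (emb (lift ord0) A).

(** * Circuits and their cost *)

Section Circuits.
Variable R : realType.
Local Notation C := R[i].
Local Notation w8 := (omega R).
Local Notation w8c := (conjc (omega R)).
Local Notation i4 := ('i : C).

Lemma i4_sqr : i4 ^+ 2 = -1.
Proof. by rewrite complexiE sqrCi. Qed.

Lemma omega_sqr : w8 ^+ 2 = i4.
Proof.
rewrite expr2 /omega; apply/eqP; rewrite eq_complex /=.
have e : pi / 4 + pi / 4 = pi / 2 :> R.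
  by rewrite [RHS]splitr -!mulrA -invfM -natrM.
have := cosD (pi / 4 : R) (pi / 4); rewrite e cos_pihalf => <-; rewrite eqxx /=.
by have /esym := sinD (pi / 4 : R) (pi / 4); rewrite e sin_pihalf addrC => ->.
Qed.

Lemma omega_conj : w8 * w8c = 1.
Proof.
apply/eqP; rewrite /omega eq_complex /= mulrN opprK -!expr2 cos2Dsin2 eqxx /=.
by rewrite mulrN [X in - X]mulrC addNr.
Qed.

Lemma omega_expr4 : w8 ^+ 4 = -1.
Proof. by rewrite (exprM _ 2 2) omega_sqr i4_sqr. Qed.

Lemma omega_expr8 : w8 ^+ 8 = 1.
Proof. by rewrite (exprM _ 4 2) omega_expr4 sqrrN expr1n. Qed.

Lemma omega_conjE : w8c = w8 ^+ 7.
Proof.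
by rewrite -[LHS]mul1r -omega_expr8 exprSr -mulrA omega_conj mulr1.
Qed.

Lemma i4_expr4 : i4 ^+ 4 = 1.
Proof. by rewrite (exprM _ 2 2) i4_sqr sqrrN expr1n. Qed.

Lemma circuit_cat n (w1 w2 : circuit n) :
  circuit_mx R (w1 ++ w2) = circuit_mx R w1 *m circuit_mx R w2.
Proof. by elim: w1 => [|g w1 IH] /=; rewrite ?mul1mx // IH mulmxA. Qed.

Lemma circuit1 n (g : gate n) : circuit_mx R [:: g] = gate_mx R g.
Proof. by rewrite /= mulmx1. Qed.

Lemma entry_hadamard (a b : bool) :
  entry (hadamard_mx R) a b = (-1) ^+ (a && b) / sqrtC 2.
Proof. by rewrite /entry !mxE !inordK; case: a b => [] []. Qed.

Lemma hadamardK n (q : 'I_n) :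
  on_qubit q (hadamard_mx R) *m on_qubit q (hadamard_mx R) = 1%:M.
Proof.
have f_inj : injective (fun _ : 'I_1 => q) by move=> x y; rewrite !ord1.
rewrite -[q]/((fun _ : 'I_1 => q) 0) -(emb_on_qubit 0 _ f_inj) -emb_mul //.
rewrite -[RHS](emb1 R (fun _ : 'I_1 => q)); congr emb; apply: ent_inj => x z.
rewrite ent_mul ent1 (reindex (fun b : bool => const_mx b : 'rV_1)) /=; last first.
  exists (fun y : 'rV[bool]_1 => y 0 0) => y _; rewrite ?mxE //.
  by apply/rowP=> r; rewrite !ord1 mxE.
rewrite big_bool /= !ent_on_qubit !entry_hadamard !mxE.
have h (u v : 'rV[bool]_1) : [forall r, (r != 0 :> 'I_1) ==> (u 0 r == v 0 r)].
  by apply/forallP=> r; rewrite ord1 eqxx.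
rewrite !h.
have -> : (x == z) = (x 0 0 == z 0 0).
  by apply/eqP/eqP=> [->//|e]; apply/rowP=> r; rewrite !ord1.
have half : (sqrtC 2)^-1 * (sqrtC 2)^-1 = 2^-1 :> C by rewrite -invfM -expr2 sqrtCK.
have one : 2^-1 + 2^-1 = 1 :> C by rewrite [RHS]splitr mul1r.
case: (x 0 0) (z 0 0) => [] [] /=; rewrite ?expr1 ?expr0 ?mulN1r ?mul1r ?mulrN ?mulNr ?opprK half;
  by rewrite ?addNr ?subrr ?one.
Qed.

Lemma phase_expr n (q : 'I_n) a k :
  iter k (mulmx (on_qubit q (phase_mx a))) 1%:M = on_qubit q (phase_mx (a ^+ k)) :> 'M[C]_(qdim n).
Proof.
elim: k => [|k IH] /=.
  by rewrite phase_gateE expr0 -mono1; apply: eq_mono => // y; case: ifP.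
rewrite IH !phase_gateE monoM; apply: eq_mono => // y /=.
by case: ifP; rewrite ?mulr1 // exprS.
Qed.

Lemma cnotK n (c t : 'I_n) : c != t -> cnot_mx R c t *m cnot_mx R c t = 1%:M.
Proof.
move=> ne; rewrite cnot_mxE monoM -mono1; apply: eq_mono => [y|y] /=; last by rewrite mulr1.
apply/rowP=> r; rewrite !mxE (negPf ne) /= addr0 -addrA.
by rewrite [X in _ + X](_ : _ = 0) ?addr0 //; case: (_ && _).
Qed.

Lemma iter_gate n (g : gate n) k :
  circuit_mx R (nseq k g) = iter k (mulmx (gate_mx R g)) 1%:M.
Proof. by elim: k => //= k ->. Qed.

(** A common exponent for all gates: seven copies of a gate are its inverse, and determinants of
    circuits are eighth roots of unity. *)
Lemma gate_expr8 n (g : gate n) : circuit_mx R (nseq 8 g) = 1%:M.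
Proof.
have phase1 q a : a ^+ 8 = 1 ->
    iter 8 (mulmx (on_qubit q (phase_mx a))) 1%:M = 1%:M :> 'M[C]_(qdim n).
  by move=> ha; rewrite phase_expr ha -(expr0 1) -phase_expr.
rewrite iter_gate; case: g => [q|q|c t ne|q|q]; rewrite /gate_mx.
- by rewrite /iter; do 4!rewrite mulmxA hadamardK mul1mx.
- by apply: phase1; rewrite (exprM _ 4 2) i4_expr4 expr1n.
- by rewrite /iter; do 4!rewrite mulmxA cnotK // mul1mx.
- exact/phase1/omega_expr8.
- by apply: phase1; rewrite omega_conjE -exprM mulnC exprM omega_expr8 expr1n.
Qed.

Lemma clifford_cat n (w1 w2 : circuit n) :
  clifford_circuit (w1 ++ w2) = clifford_circuit w1 && clifford_circuit w2.
Proof. exact: all_cat. Qed.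

Lemma clifford_inv n (w : circuit n) : clifford_circuit w ->
  exists2 w', clifford_circuit w' & circuit_mx R w *m circuit_mx R w' = 1%:M.
Proof.
elim: w => [_|g w IH /= /andP[cg /IH [w' cw' e]]]; first by exists [::]; rewrite //= mul1mx.
exists (w' ++ nseq 7 g); first by rewrite clifford_cat cw' /clifford_circuit all_nseq cg.
rewrite circuit_cat mulmxA -[_ *m _ *m circuit_mx R w']mulmxA e mulmx1.
exact: (gate_expr8 g).
Qed.

Lemma det_circuit_expr8 n (w : circuit n) : \det (circuit_mx R w) ^+ 8 = 1.
Proof.
elim: w => [|g w IH] /=; first by rewrite det1 expr1n.
rewrite det_mulmx exprMn IH mulr1.
have := congr1 determinant (gate_expr8 g).
by rewrite /= !det_mulmx det1 mulr1 => <-.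
Qed.

Definition costs n (W : 'M[C]_(qdim n)) (D T : nat) : Prop :=
  exists D' T', [/\ (D' <= D)%N, (T' <= T)%N & implements W D' T'].

Lemma costs_le n (W : 'M[C]_(qdim n)) D T D' T' :
  costs W D T -> (D <= D')%N -> (T <= T')%N -> costs W D' T'.
Proof.
case=> D1 [T1 [lD lT h]] lD' lT'; exists D1, T1.
by rewrite (leq_trans lD) // (leq_trans lT).
Qed.

(** A Clifford prefix merges into the leading Clifford block; hence T-depths simply add when
    circuits are concatenated. *)
Lemma clifford_T_form_clifford n (k w : circuit n) D T :
  clifford_circuit k -> clifford_T_form w D T -> clifford_T_form (k ++ w) D T.
Proof.
move=> ck; case=> [k' ck'|k' l w' D' T' ck' hl hw'].
  by apply: CliffordTForm0; rewrite clifford_cat ck.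
by rewrite catA; apply: CliffordTFormS => //; rewrite clifford_cat ck.
Qed.

Lemma clifford_T_form_cat n (w1 w2 : circuit n) D1 T1 D2 T2 :
  clifford_T_form w1 D1 T1 -> clifford_T_form w2 D2 T2 ->
  clifford_T_form (w1 ++ w2) (D1 + D2) (T1 + T2).
Proof.
move=> h1 h2; elim: h1 => [k ck|k l w D T ck hl _ IH].
  exact: clifford_T_form_clifford.
by rewrite -!catA addSn -addnA; apply: CliffordTFormS.
Qed.

Lemma costs_mul n (W1 W2 : 'M[C]_(qdim n)) D1 T1 D2 T2 :
  costs W1 D1 T1 -> costs W2 D2 T2 -> costs (W1 *m W2) (D1 + D2) (T1 + T2).
Proof.
move=> [d1 [t1 [l1 m1 [w1 f1 <-]]]] [d2 [t2 [l2 m2 [w2 f2 <-]]]].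
exists (d1 + d2)%N, (t1 + t2)%N; rewrite !leq_add //; split=> //.
exists (w1 ++ w2); [exact: clifford_T_form_cat|exact: circuit_cat].
Qed.

Lemma costs_clifford n (w : circuit n) :
  clifford_circuit w -> costs (circuit_mx R w) 0 0.
Proof. by move=> cw; exists 0%N, 0%N; split=> //; exists w => //; apply: CliffordTForm0. Qed.

Lemma costs_layer n (l : circuit n) :
  T_layer l -> costs (circuit_mx R l) 1 (size l).
Proof.
move=> hl; exists 1%N, (size l); split=> //; exists l => //.
rewrite -[l]cats0 -[_ ++ _]cat0s -[size _]addn0 cats0 -{1}[l]cats0.
by apply: CliffordTFormS => //; apply: CliffordTForm0.
Qed.

Definition gmap m n (f : 'I_m -> 'I_n) (f_inj : injective f) (g : gate m) : gate n :=
  match g with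
  | GateH q => GateH (f q)
  | GateS q => GateS (f q)
  | GateCNOT c t ne => GateCNOT (contra_neq (@f_inj c t) ne)
  | GateT q => GateT (f q)
  | GateTdg q => GateTdg (f q)
  end.

Lemma emb_gate m n (f : 'I_m -> 'I_n) (f_inj : injective f) (g : gate m) :
  emb f (gate_mx R g) = gate_mx R (gmap f_inj g).
Proof. by case: g => *; rewrite ?emb_on_qubit ?emb_cnot. Qed.

Lemma emb_circuit m n (f : 'I_m -> 'I_n) (f_inj : injective f) (w : circuit m) :
  emb f (circuit_mx R w) = circuit_mx R (map (gmap f_inj) w).
Proof.
elim: w => [|g w IH] /=; first by rewrite emb1.
by rewrite emb_mul // IH (emb_gate f_inj).
Qed.

Lemma is_T_gmap m n (f : 'I_m -> 'I_n) (f_inj : injective f) g :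
  is_T (gmap f_inj g) = is_T g.
Proof. by case: g. Qed.

Lemma clifford_gmap m n (f : 'I_m -> 'I_n) (f_inj : injective f) w :
  clifford_circuit (map (gmap f_inj) w) = clifford_circuit w.
Proof.
by rewrite /clifford_circuit all_map; apply: eq_all => g /=; rewrite is_T_gmap.
Qed.

Lemma T_layer_gmap m n (f : 'I_m -> 'I_n) (f_inj : injective f) w :
  T_layer (map (gmap f_inj) w) = T_layer w.
Proof.
rewrite /T_layer all_map; congr (_ && _).
  by apply: eq_all => g /=; rewrite is_T_gmap.
rewrite -map_comp -(map_inj_uniq f_inj) map_flatten -map_comp.
by congr (uniq (flatten _)); apply: eq_map => -[].
Qed.

Lemma costs_emb m n (f : 'I_m -> 'I_n) (W : 'M[C]_(qdim m)) D T :
  injective f -> costs W D T -> costs (emb f W) D T.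
Proof.
move=> f_inj [d [t [ld lt [w hw <-]]]]; exists d, t; split=> //.
exists (map (gmap f_inj) w); last by rewrite emb_circuit.
elim: hw => [k ck|k l w' D' T' ck hl _ IH].
  by apply: CliffordTForm0; rewrite clifford_gmap.
rewrite !map_cat -(size_map (gmap f_inj) l).
by apply: CliffordTFormS; rewrite ?clifford_gmap ?T_layer_gmap.
Qed.

Lemma costs_conj n (w : circuit n) (U K' : 'M[C]_(qdim n)) D T :
  clifford_circuit w -> circuit_mx R w *m K' = 1%:M ->
  costs (controlled_mx U) D T ->
  costs (controlled_mx (circuit_mx R w *m U *m K')) D T.
Proof.
move=> cw e hU; have [w' cw' e'] := clifford_inv cw.
have lift_inj' := @lift_inj n.+1 ord0.
have -> : K' = circuit_mx R w'.
  by rewrite -[LHS]mul1mx -(mulmx1C e') -mulmxA e mulmx1.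
rewrite controlled_conj // -[D]addn0 -[T]addn0.
apply: costs_mul; last by apply/costs_emb/costs_clifford.
by rewrite -[D]add0n -[T]add0n; apply: costs_mul => //; apply/costs_emb/costs_clifford.
Qed.

Lemma costs_controlled_mul n (U V : 'M[C]_(qdim n)) D1 T1 D2 T2 :
  costs (controlled_mx U) D1 T1 -> costs (controlled_mx V) D2 T2 ->
  costs (controlled_mx (U *m V)) (D1 + D2) (T1 + T2).
Proof. by rewrite controlled_mul; apply: costs_mul. Qed.

End Circuits.

(** * Roots of unity in Q(omega) *)

Lemma rat_sqr_half (p : rat) : p ^+ 2 *+ 2 != 1.
Proof.
apply/eqP=> h.
have d0 : (denq p)%:~R != 0 :> rat by rewrite intr_eq0 denq_neq0.
have : (`|numq p| ^ 2 * 2 = `|denq p| ^ 2)%N.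
  apply/eqP; rewrite -(eqr_nat rat) natrM !natrX !natr_absz !intr_norm !real_normK ?num_real //.
  move: h; rewrite -{1}[p]divq_num_den expr_div_n => /(congr1 (fun x => x * (denq p)%:~R ^+ 2)).
  by rewrite mul1r -mulr_natr mulrAC divfK ?expf_neq0 // => ->.
have d1 : (0 < `|denq p|)%N by rewrite absz_gt0 denq_neq0.
move=> e; have n1 : (0 < `|numq p|)%N.
  rewrite lt0n; apply/eqP=> n0; move/esym/eqP: e.
  by rewrite n0 expn_eq0 eqn0Ngt d1.
(* The exponent of 2 is odd on the left and even on the right. *)
have := congr1 (fun k => odd (logn 2 k)) e.
by rewrite lognM ?expn_gt0 ?n1 // !lognX oddD !oddM.
Qed.

Section Field.
Variable R : realType.
Local Notation C := R[i].
Local Notation w8 := (omega R).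
Local Notation i4 := ('i : C).

Definition inQi (z : C) : Prop := exists p q : rat, z = ratr p +i* ratr q.

Lemma inQiD x y : inQi x -> inQi y -> inQi (x + y).
Proof.
by move=> [p [q ->]] [r [s ->]]; exists (p + r), (q + s); rewrite !rmorphD.
Qed.

Lemma inQiM x y : inQi x -> inQi y -> inQi (x * y).
Proof.
move=> [p [q ->]] [r [s ->]]; exists (p * r - q * s), (p * s + q * r).
by rewrite !rmorphD rmorphN !rmorphM.
Qed.

Lemma inQiV x : inQi x -> inQi x^-1.
Proof.
move=> [p [q ->]]; exists (p / (p ^+ 2 + q ^+ 2)), (- (q / (p ^+ 2 + q ^+ 2))).
by rewrite rmorphN !rmorphM !fmorphV rmorphD !rmorphXn.
Qed.

Lemma inQi1 : inQi 1.
Proof. by exists 1, 0; rewrite rmorph1 rmorph0. Qed.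

Lemma inQi0 : inQi 0.
Proof. by exists 0, 0; rewrite rmorph0. Qed.

Lemma inQi_i : inQi i4.
Proof. by exists 0, 1; rewrite rmorph1 rmorph0. Qed.

Lemma inQiN x : inQi x -> inQi (- x).
Proof.
by move=> [p [q ->]]; exists (- p), (- q); rewrite !rmorphN.
Qed.

(** (p + q i)^2 = i or -i forces p^2 = q^2 and 4 p^2 q^2 = 1, so 2 p^2 = 1 or -1, and neither has a
    rational solution. Hence omega has degree 2 over Q(i). *)
Lemma inQi_sqr z : inQi z -> z ^+ 2 != i4 /\ z ^+ 2 != - i4.
Proof.
move=> [p [q ->]].
suff h (e : rat) : e ^+ 2 = 1 -> (ratr p +i* ratr q) ^+ 2 != 0 +i* ratr e :> C.
  split; first by have := h 1 (expr1n _ _); rewrite rmorph1.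
  have -> : - i4 = 0 +i* ratr (-1) :> C by rewrite rmorphN rmorph1 /GRing.opp /= oppr0.
  by apply: h; rewrite sqrrN expr1n.
move=> e1; apply/eqP; rewrite expr2 => -[].
rewrite -!rmorphM -rmorphB -rmorphD -{1}(rmorph0 (ratr : rat -> R)).
move/fmorph_inj=> h1 /fmorph_inj h2.
have hpq : p ^+ 2 = q ^+ 2 by apply/eqP; rewrite -subr_eq0 !expr2 h1.
have := rat_sqr_half p.
have h4 : (p ^+ 2 *+ 2) ^+ 2 = 1.
  by rewrite -e1 -h2 [q * p]mulrC -mulr2n !exprMn_n !exprMn -hpq.
have : (p ^+ 2 *+ 2 == 1) || (p ^+ 2 *+ 2 == -1) by rewrite -sqrf_eq1 h4.
case/orP=> [->//|/eqP hn].
by have := mulrn_wge0 2 (sqr_ge0 p); rewrite hn oppr_ge0 ler10.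
Qed.

Definition inQw (z : C) : Prop := exists a b : C, [/\ inQi a, inQi b & z = a + b * w8].

Lemma inQwD x y : inQw x -> inQw y -> inQw (x + y).
Proof.
move=> [a [b [ha hb ->]]] [c [d [hc hd ->]]]; exists (a + c), (b + d).
by split; [exact: inQiD|exact: inQiD|rewrite mulrDl addrACA].
Qed.

Lemma inQwM x y : inQw x -> inQw y -> inQw (x * y).
Proof.
move=> [a [b [ha hb ->]]] [c [d [hc hd ->]]].
exists (a * c + b * d * i4), (a * d + b * c); split.
- by apply: inQiD; [|apply: inQiM inQi_i]; apply: inQiM.
- by apply: inQiD; apply: inQiM.
rewrite -omega_sqr; ring.
Qed.

Lemma inQw_Qi x : inQi x -> inQw x.
Proof. by move=> hx; exists x, 0; split=> //; [exact: inQi0|rewrite mul0r addr0]. Qed.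

Lemma inQw_omega : inQw w8.
Proof.
by exists 0, 1; split; [exact: inQi0|exact: inQi1|rewrite mul1r add0r].
Qed.

Lemma inQwX x k : inQw x -> inQw (x ^+ k).
Proof.
move=> hx; elim: k => [|k IH]; first exact/inQw_Qi/inQi1.
by rewrite exprS; apply: inQwM.
Qed.

(** The square of omega + omega^7 is i + 2 - i = 2, so it is a square root of 2; either sign lies in
    Q(omega). This covers the entries of H. *)
Lemma inQw_sqrt2 : inQw (sqrtC 2)^-1.
Proof.
have e : (w8 + w8 ^+ 7) ^+ 2 = 2.
  rewrite sqrrD -exprS omega_expr8 -exprM (exprM _ 2 7) omega_sqr.
  by rewrite (exprD _ 4 3) i4_expr4 mul1r exprS i4_sqr mulrN1 addrAC subrr add0r.
have h : inQw (w8 + w8 ^+ 7) by apply: inQwD; [|apply: inQwX]; apply: inQw_omega.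
have h2 : inQi 2^-1 by apply/inQiV/(inQiD inQi1 inQi1).
have -> : (sqrtC 2)^-1 = sqrtC 2 * 2^-1 :> C.
  by rewrite -[X in _ / X]sqrtCK expr2 invfM mulrA divff ?mul1r // sqrtC_eq0 pnatr_eq0.
apply: inQwM; last exact: inQw_Qi.
have : (sqrtC 2 == w8 + w8 ^+ 7) || (sqrtC 2 == - (w8 + w8 ^+ 7)).
  by rewrite -eqf_sqr sqrtCK e.
case/orP=> /eqP-> //; rewrite -mulN1r; apply: inQwM => //.
exact/inQw_Qi/inQiN/inQi1.
Qed.

Lemma inQw_independent u v : inQi u -> inQi v -> u + v * w8 = 0 -> u = 0 /\ v = 0.
Proof.
move=> hu hv e; case: (eqVneq v 0) => [v0|v0].
  by move: e; rewrite v0 mul0r addr0.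
have [] := inQi_sqr (inQiM hu (inQiV hv)).
have -> : u = - (v * w8) by apply/eqP; rewrite -addr_eq0 e.
by rewrite mulNr sqrrN mulrAC divff // mul1r omega_sqr eqxx.
Qed.

(** Comparing coefficients in (a + b omega)^2 = c omega gives a^2 + i b^2 = 0 and 2 a b = c. Then b
    is nonzero and (a / b)^2 = -i, which is excluded in Q(i). *)
Lemma inQw_sqr_omega z c : inQw z -> inQi c -> c != 0 -> z ^+ 2 != c * w8.
Proof.
move=> [a [b [ha hb ->]]] hc c0; apply/eqP=> e.
have ha2 := inQiM ha ha; have hb2 := inQiM hb hb; have hab := inQiM ha hb.
have hu : inQi (a * a + b * b * i4) by apply: inQiD => //; apply: inQiM inQi_i.
have hv : inQi (a * b + a * b + - c) by apply: inQiD (inQiN hc); apply: inQiD.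
have [|e1 e2] := inQw_independent hu hv.
  have <- : (a + b * w8) ^+ 2 - c * w8 = 0 by rewrite e subrr.
  rewrite -omega_sqr; ring.
have b0 : b != 0.
  apply/eqP=> b0; move: e2; rewrite b0 mulr0 !add0r => /eqP.
  by rewrite oppr_eq0 (negPf c0).
have [_ /eqP[]] := inQi_sqr (inQiM ha (inQiV hb)).
have h : a ^+ 2 = - (b ^+ 2 * i4) by apply/eqP; rewrite -addr_eq0 !expr2 e1.
by rewrite exprMn h exprVn mulNr mulrAC divff ?mul1r // expf_neq0.
Qed.

(** Descent on k: if b = z^(2^k) had b^8 = -1, then b^2 = c omega with c^4 = 1. Such a c lies in
    Q(i), so c omega is no square in Q(omega). *)
Lemma inQw_root_of_unity z k : inQw z -> z ^+ (2 ^ (k + 3)) = 1 -> z ^+ 8 = 1.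
Proof.
move=> hz; elim: k => [//|k IH] e; apply: IH.
rewrite expnD exprM; set b := z ^+ (2 ^ k).
have hb : inQw b by apply: inQwX.
have : b ^+ 8 ^+ 2 = 1 by rewrite -[RHS]e addSnnS expnD exprM -exprM.
move/eqP; rewrite sqrf_eq1 => /orP[/eqP //|/eqP hN].
pose c := b ^+ 2 * w8 ^+ 7.
have hc : b ^+ 2 = c * w8 by rewrite -mulrA -exprSr omega_expr8 mulr1.
have c4 : (c ^+ 2) ^+ 2 = 1.
  rewrite -exprM /c exprMn -(exprM b 2 4) hN -exprM (exprM _ 4 7) omega_expr4.
  by rewrite -signr_odd /= expr1 mulrNN mulr1.
have [i0 i1] := (inQi_i, inQi1).
have hQ : inQi c.
  move/eqP: c4; rewrite sqrf_eq1 => /orP[|].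
    by rewrite sqrf_eq1 => /orP[] /eqP->; [|apply: inQiN].
  by rewrite -(i4_sqr R) eqf_sqr => /orP[] /eqP->; [|apply: inQiN].
have c0 : c != 0 by apply/eqP=> c0; move/eqP: c4; rewrite c0 !expr0n /= eq_sym oner_eq0.
by have := inQw_sqr_omega hb hQ c0; rewrite hc eqxx.
Qed.

Lemma inQw_circuit n (w : circuit n) x y : inQw (ent (circuit_mx R w) x y).
Proof.
have q0 : inQw 0 by apply/inQw_Qi/inQi0.
have q1 : inQw 1 by apply/inQw_Qi/inQi1.
have hphase (q : 'I_n) a u v : inQw a -> inQw (ent (on_qubit q (phase_mx a)) u v).
  by move=> ha; rewrite phase_gateE ent_mono; do 2?case: ifP => _.
have hg (g : gate n) u v : inQw (ent (gate_mx R g) u v).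
  case: g => [q|q|c t ne|q|q]; rewrite /gate_mx.
  - rewrite ent_on_qubit; case: ifP => // _; rewrite entry_hadamard.
    apply: inQwM inQw_sqrt2; apply/inQwX/inQw_Qi/inQiN/inQi1.
  - exact/hphase/inQw_Qi/inQi_i.
  - by rewrite cnot_mxE ent_mono; case: ifP.
  - exact/hphase/inQw_omega.
  - by apply: hphase; rewrite omega_conjE; apply/inQwX/inQw_omega.
elim: w x y => [|g w IH] x y /=; first by rewrite ent1; case: eqP.
by rewrite ent_mul; apply: big_ind => // [u v|z _]; [exact: inQwD|exact: inQwM].
Qed.

Lemma omega_primitive : 8.-primitive_root w8.
Proof.
have [m pm dm] := prim_order_exists (isT : 0 < 8)%N (omega_expr8 R).
suff e : m = 8%N by rewrite -{}e.
have : ~~ (m %| 4)%N.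
  by rewrite (prim_order_dvd pm) omega_expr4 eq_sym -subr_eq0 opprK -mulr2n pnatr_eq0.
have := dvdn_leq (isT : 0 < 8)%N dm; move: dm; clear pm.
by do 9?[case: m => [|m] //].
Qed.

Lemma inQw_omega_power z k :
  inQw z -> z ^+ (2 ^ (k + 3)) = 1 -> exists2 j, (j < 8)%N & z = w8 ^+ j.
Proof.
move=> hz /(inQw_root_of_unity hz)/(prim_rootP omega_primitive)[j ->].
by exists j.
Qed.

(** The determinant a^(2^n) is an eighth root of unity, so a has order a power of 2; and a is a
    matrix entry, hence in Q(omega). *)
Lemma scalar_circuit n (w : circuit n) a :
  circuit_mx R w = a%:M -> exists2 j, (j < 8)%N & a = w8 ^+ j.
Proof.
move=> e; apply: (inQw_omega_power (k := n)).
  by have := inQw_circuit w 0 0; rewrite e /ent mxE eqxx mulr1n.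
by have := det_circuit_expr8 R w; rewrite e det_scalar -exprM qdimE expnD.
Qed.

End Field.

(** * Pauli operators and the symplectic action of Clifford circuits *)

Definition dotv n (u v : 'rV[bool]_n) : bool := (u *m v^T) 0 0.

Lemma dotvE n (u v : 'rV[bool]_n) : dotv u v = \sum_q u 0 q * v 0 q.
Proof. by rewrite /dotv mxE; apply: eq_bigr => q _; rewrite mxE. Qed.

Lemma dotvDl n (u v w : 'rV[bool]_n) : dotv (u + v) w = dotv u w + dotv v w.
Proof. by rewrite /dotv mulmxDl mxE. Qed.

Lemma dotvDr n (u v w : 'rV[bool]_n) : dotv w (u + v) = dotv w u + dotv w v.
Proof. by rewrite /dotv linearD mulmxDr mxE. Qed.

Lemma dotvC n (u v : 'rV[bool]_n) : dotv u v = dotv v u.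
Proof. by rewrite !dotvE; apply: eq_bigr => q _; rewrite mulrC. Qed.

Lemma dotv_delta n (u : 'rV[bool]_n) q : dotv u (delta_mx 0 q) = u 0 q.
Proof.
rewrite dotvE (bigD1 q) //= mxE !eqxx mulr1 big1 ?addr0 // => r ne.
by rewrite mxE (negPf ne) mulr0.
Qed.

Lemma dotv0r n (u : 'rV[bool]_n) : dotv u 0 = false.
Proof. by rewrite /dotv trmx0 mulmx0 mxE. Qed.

Section Pauli.
Variable R : realType.
Local Notation C := R[i].
Local Notation i4 := (Complex 0 1 : C).
Implicit Types n : nat.

Lemma i4_neq0 : i4 != 0.
Proof.
apply/eqP=> e; have /eqP := i4_expr4 R.
by rewrite e expr0n eq_sym oner_eq0.
Qed.

Definition sg (b : bool) : C := (-1) ^+ b.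

Lemma sgD (a b : bool) : sg (a + b) = sg a * sg b.
Proof. exact: signr_addb. Qed.

Lemma sgK (b : bool) : sg b * sg b = 1.
Proof. by rewrite -sgD addrr_pchar2 // /sg. Qed.

Lemma sg_neq0 (b : bool) : sg b != 0.
Proof. by rewrite /sg signr_eq0. Qed.

Lemma sg_inj : injective sg.
Proof.
by move=> a b /eqP; rewrite /sg (inj_eq (@signr_inj _)) => /eqP.
Qed.

(** No factor i is attached, so products only produce signs and the square is 1 or -1. *)
Definition pauli n (v : 'rV[bool]_(n + n)) : 'M[C]_(qdim n) :=
  mono (fun y => y + lsubmx v) (fun y => sg (dotv (rsubmx v) y)).

Lemma pauli0 n : @pauli n 0 = 1%:M.
Proof.
rewrite -mono1; apply: eq_mono => y; first by rewrite linear0 addr0.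
by rewrite linear0 /sg dotvC dotv0r.
Qed.

Lemma pauliM n (u v : 'rV[bool]_(n + n)) :
  pauli u *m pauli v = sg (dotv (rsubmx u) (lsubmx v)) *: pauli (u + v).
Proof.
rewrite monoM monoZ; apply: eq_mono => y /=.
  by rewrite linearD /= -addrA [lsubmx v + _]addrC.
by rewrite dotvDr linearD /= dotvDl !sgD mulrAC mulrC mulrA.
Qed.

Definition sympl n (u v : 'rV[bool]_(n + n)) : bool :=
  (u *m Omega n *m v^T) 0 0.

Lemma symplE n (u v : 'rV[bool]_(n + n)) :
  sympl u v = dotv (rsubmx u) (lsubmx v) + dotv (lsubmx u) (rsubmx v).
Proof.
rewrite /sympl -{1}[u]hsubmxK mul_row_block !simpmx -{1}[v]hsubmxK.
by rewrite tr_row_mx mul_row_col mxE.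
Qed.

Lemma pauli_comm n (u v : 'rV[bool]_(n + n)) :
  pauli u *m pauli v = sg (sympl u v) *: (pauli v *m pauli u).
Proof.
rewrite !pauliM scalerA symplE sgD [v + u]addrC [dotv (lsubmx u) _]dotvC.
by rewrite -mulrA sgK mulr1.
Qed.

Lemma pauli_sqr n (v : 'rV[bool]_(n + n)) :
  pauli v *m pauli v = (sg (dotv (rsubmx v) (lsubmx v)))%:M.
Proof. by rewrite pauliM addmm2 pauli0 scalemx1. Qed.

Lemma unit_neq0 n (W W' : 'M[C]_(qdim n)) : W *m W' = 1%:M -> W != 0.
Proof.
move=> e; apply/eqP=> W0; move: e; rewrite W0 mul0mx => /matrixP/(_ (idx 0) (idx 0)).
by rewrite !mxE eqxx => /eqP; rewrite eq_sym oner_eq0.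
Qed.

(** Commuting with the X operators makes the entries translation invariant; commuting with the Z
    operators kills those off the diagonal. *)
Lemma pauli_centralizer n (V : 'M[C]_(qdim n)) :
  (forall v, V *m pauli v = pauli v *m V) -> V = (ent V 0 0)%:M.
Proof.
move=> h.
have hX x y a : ent V (x + a) (y + a) = ent V x y.
  have := congr1 (fun M => ent M (x + a) y) (h (row_mx a 0)).
  rewrite ent_mul_mono row_mxKl row_mxKr dotvC dotv0r mulr1 => ->.
  rewrite ent_mul (bigD1 x) //= ent_mono row_mxKl row_mxKr eqxx dotvC dotv0r mul1r.
  rewrite big1 ?addr0 // => z ne; rewrite ent_mono row_mxKl (inj_eq (addIr a)).
  by rewrite eq_sym (negPf ne) mul0r.
apply: ent_inj => x y.
have -> : ent (ent V 0 0)%:M x y = if x == y then ent V 0 0 else 0.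
  by rewrite {1}/ent mxE (can_eq (@idxK n)); case: eqP.
case: eqVneq => [<-|ne]; first by rewrite -(hX x x x) addmm2.
have [q hq] : exists q, x 0 q != y 0 q.
  apply/existsP; apply: contraT; rewrite negb_exists => /forallP e.
  by case/eqP: ne; apply/rowP=> q; apply/eqP; have := e q; rewrite negbK.
have := congr1 (fun M => ent M x y) (h (row_mx 0 (delta_mx 0 q))).
have -> : pauli (row_mx 0 (delta_mx 0 q)) = mono id (fun y => sg (y 0 q)).
  apply: eq_mono => z; first by rewrite row_mxKl addr0.
  by rewrite row_mxKr dotvC dotv_delta.
rewrite ent_mul_mono ent_diag_mul mulrC.
have -> : y 0 q = ~~ x 0 q by move: hq; case: (x 0 q) (y 0 q) => [] [].
case: (x 0 q); rewrite /sg /= expr1 expr0 mul1r mulN1r => e.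
  by apply/eqP; rewrite -eqNr; apply/eqP.
by apply/eqP; rewrite -eqNr; apply/eqP.
Qed.

Lemma scale_unit_inj n (W W' : 'M[C]_(qdim n)) (a b : C) :
  W *m W' = 1%:M -> a *: W = b *: W -> a = b.
Proof.
move=> WW' /eqP; rewrite -subr_eq0 -scalerBl scaler_eq0 (negPf (unit_neq0 WW')).
by rewrite orbF subr_eq0 => /eqP.
Qed.

Definition pauli_inv n (v : 'rV[bool]_(n + n)) : 'M[C]_(qdim n) :=
  sg (dotv (rsubmx v) (lsubmx v)) *: pauli v.

Lemma pauliV n (v : 'rV[bool]_(n + n)) : pauli v *m pauli_inv v = 1%:M.
Proof. by rewrite -scalemxAr pauli_sqr scale_scalar_mx sgK. Qed.

(** The scalars are signs because Pauli squares are scalar, and they form a character of F_2^(2n).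
    By nondegeneracy of the symplectic form some Pauli operator has the same commutation signs, and
    its product with W is central. *)
Lemma pauli_twisted n (W W' : 'M[C]_(qdim n)) :
  W *m W' = 1%:M ->
  (forall v, exists s, W *m pauli v = s *: (pauli v *m W)) ->
  exists a u, W = a *: pauli u.
Proof.
move=> WW' tw.
pose chi v := W *m pauli v != pauli v *m W.
have chiE v : W *m pauli v = sg (chi v) *: (pauli v *m W).
  rewrite /chi; case: eqP => [->|ne]; first by rewrite scale1r.
  have [s e] := tw v.
  have : W *m (pauli v *m pauli v) = s ^+ 2 *: (pauli v *m pauli v *m W).
    by rewrite mulmxA e -scalemxAl -mulmxA e -scalemxAr scalerA mulmxA.
  rewrite pauli_sqr mul_mx_scalar mul_scalar_mx scalerA => /(scale_unit_inj WW').
  rewrite -{1}[sg _]mul1r => /(mulIf (sg_neq0 _))/esym/eqP.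
  rewrite sqrf_eq1 => /orP[] /eqP es; last by rewrite e es /sg expr1.
  by case: ne; rewrite e es scale1r.
have chiD u v : chi (u + v) = chi u + chi v.
  apply: sg_inj; rewrite sgD.
  have hP : pauli u *m pauli v *m W *m (W' *m (pauli_inv v *m pauli_inv u)) = 1%:M.
    rewrite !mulmxA -[_ *m W *m W']mulmxA WW' mulmx1.
    by rewrite -[_ *m pauli v *m _]mulmxA pauliV mulmx1 pauliV.
  apply: (scale_unit_inj hP).
  have <- : W *m (pauli u *m pauli v) =
      (sg (chi u) * sg (chi v)) *: (pauli u *m pauli v *m W).
    rewrite mulmxA chiE -scalemxAl -mulmxA chiE -scalemxAr scalerA mulmxA.
    by [].
  rewrite pauliM -scalemxAr chiE -!scalemxAl !scalerA.
  by rewrite mulrC.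
have chi0 : chi 0 = false by rewrite /chi pauli0 mulmx1 mul1mx eqxx.
pose w : 'rV[bool]_(n + n) := \row_q chi (delta_mx 0 q).
have chi_dot v : chi v = dotv w v.
  rewrite [v]matrix_sum_delta big_ord1.
  apply: (big_ind (fun v => chi v = dotv w v)) => [|u1 u2 h1 h2|q _].
  - by rewrite chi0 dotv0r.
  - by rewrite chiD h1 h2 dotvDr.
  case: (v 0 q); first by rewrite scale1r dotv_delta mxE.
  by rewrite scale0r chi0 dotv0r.
(* Since [Omega n] squares to 1, this u represents the character through [sympl]. *)
pose u := w *m Omega n.
have chi_u v : chi v = sympl u v.
  rewrite chi_dot /dotv /sympl /u -[w *m _ *m _]mulmxA.
  by rewrite mulmx_block !simpmx -scalar_mx_block mulmx1.
have com v : W *m pauli u *m pauli v = pauli v *m (W *m pauli u).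
  rewrite -mulmxA pauli_comm -scalemxAr (mulmxA W) chiE -scalemxAl scalerA chi_u.
  by rewrite sgK scale1r mulmxA.
have := pauli_centralizer com; move: (ent _ 0 0) => lam hW.
exists (lam * sg (dotv (rsubmx u) (lsubmx u))), u.
by rewrite -[LHS]mulmx1 -(pauliV u) mulmxA hW mul_scalar_mx scalerA.
Qed.

(** The conjugation relation K P_v K^-1 ~ P_(v M), written without inverses. The row convention
    reverses products in [acts_mul]. *)
Definition acts n (K : 'M[C]_(qdim n)) (M : 'M[bool]_(n + n)) : Prop :=
  forall v, exists2 s : C, s != 0 & K *m pauli v = s *: (pauli (v *m M) *m K).

Lemma acts1 n : acts (1%:M : 'M[C]_(qdim n)) 1%:M.
Proof.
by move=> v; exists 1; rewrite ?oner_neq0 // scale1r !mulmx1 mul1mx.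
Qed.

Lemma acts_mul n (K1 K2 : 'M[C]_(qdim n)) M1 M2 :
  acts K1 M1 -> acts K2 M2 -> acts (K1 *m K2) (M2 *m M1).
Proof.
move=> h1 h2 v; have [s2 s20 e2] := h2 v; have [s1 s10 e1] := h1 (v *m M2).
exists (s1 * s2); first by rewrite mulf_neq0.
by rewrite -mulmxA e2 -scalemxAr (mulmxA K1) e1 -scalemxAl scalerA mulrC !mulmxA.
Qed.

(** Conjugation preserves the commutation sign of two Pauli operators, and that sign is the
    symplectic form. *)
Lemma acts_symplectic n (K K' : 'M[C]_(qdim n)) M :
  K *m K' = 1%:M -> acts K M -> symplectic M.
Proof.
move=> KK' aK.
have h u v : sympl (u *m M) (v *m M) = sympl u v.
  apply: sg_inj.
  have [s s0 es] := aK u; have [t t0 et] := aK v.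
  have mulK a b sa sb : K *m pauli a = sa *: (pauli (a *m M) *m K) ->
      K *m pauli b = sb *: (pauli (b *m M) *m K) ->
      K *m (pauli a *m pauli b) =
      (sa * sb) *: (pauli (a *m M) *m pauli (b *m M) *m K).
    move=> ea eb; rewrite mulmxA ea -scalemxAl -mulmxA eb -scalemxAr scalerA.
    by rewrite mulmxA.
  have hP : pauli (v *m M) *m pauli (u *m M) *m K *m
      (K' *m (pauli_inv (u *m M) *m pauli_inv (v *m M))) = 1%:M.
    rewrite !mulmxA -[_ *m K *m K']mulmxA KK' mulmx1.
    by rewrite -[_ *m pauli_inv (u *m M)]mulmxA pauliV mulmx1 pauliV.
  apply: (mulfI (mulf_neq0 s0 t0)); apply: (scale_unit_inj hP).
  rewrite -scalerA scalemxAl -pauli_comm -mulK // pauli_comm -scalemxAr.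
  by rewrite (mulK _ _ _ _ et es) scalerA mulrC [t * s]mulrC.
apply/matrixP=> i j; have := h (delta_mx 0 i) (delta_mx 0 j).
rewrite /sympl trmx_mul trmx_delta !mulmxA -[_ *m M *m _ *m _]mulmxA -[_ *m M *m _]mulmxA.
by rewrite [M *m (_ *m _)]mulmxA -!rowE -!colE ![col _ _ _ _]mxE ![row _ _ _ _]mxE.
Qed.

Lemma acts_uniq n (K K' K1 K1' : 'M[C]_(qdim n)) M :
  K *m K' = 1%:M -> K1 *m K1' = 1%:M -> acts K M -> acts K1 M ->
  exists a u, K = a *: (K1 *m pauli u).
Proof.
move=> e e1 aK aK1.
have [||a [u hu]] := @pauli_twisted n (K1' *m K) (K' *m K1).
- by rewrite mulmxA -[_ *m K *m K']mulmxA e mulmx1 (mulmx1C e1).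
- move=> v; have [s s0 es] := aK v; have [t t0 et] := aK1 v.
  exists (s / t); rewrite -mulmxA es -scalemxAr mulmxA -scalerA; congr (_ *: _).
  have -> : pauli (v *m M) = t^-1 *: (K1 *m pauli v *m K1').
    by rewrite et -scalemxAl scalerA mulVf // scale1r -mulmxA e1 mulmx1.
  rewrite -scalemxAl -scalemxAr; congr (_ *: _).
  by rewrite !mulmxA (mulmx1C e1) mul1mx.
exists a, u; rewrite scalemxAr -hu mulmxA e1 mul1mx.
by [].
Qed.

Lemma acts_mono n s phi M :
  (forall a b : 'rV[bool]_n, exists2 t : C, t != 0 &
     let v := row_mx a b *m M in
     forall y, s (y + a) = s y + lsubmx v /\
       phi (y + a) * sg (dotv b y) = t * (sg (dotv (rsubmx v) (s y)) * phi y)) ->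
  acts (mono s phi) M.
Proof.
move=> h v; rewrite -[v]hsubmxK; have [t t0 e] := h (lsubmx v) (rsubmx v).
exists t => //; rewrite !monoM monoZ; apply: eq_mono => y /=; rewrite ?row_mxKl ?row_mxKr;
  by have [e1 e2] := e y.
Qed.

Definition Lin n (A : 'M[bool]_n) : 'M[C]_(qdim n) := mono (mulmxr A) (fun=> 1).

Lemma LinM n (A B : 'M[bool]_n) : Lin (A *m B) = Lin B *m Lin A.
Proof.
by rewrite monoM; apply: eq_mono => y; rewrite /= ?mulr1 // mulmxA.
Qed.

Lemma Lin1 n : Lin (1%:M : 'M_n) = 1%:M.
Proof. by rewrite -mono1; apply: eq_mono => y //=; rewrite mulmx1. Qed.

Lemma acts_Lin n (A : 'M[bool]_n) : A \in unitmx -> acts (Lin A) (symp_d A).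
Proof.
move=> uA; apply: acts_mono => a b; exists 1; first exact: oner_neq0.
move=> v y /=; rewrite /v mul_row_block !simpmx row_mxKl row_mxKr.
rewrite mulmxDl !mul1r mulr1; split=> //.
by rewrite /dotv trmx_mul -mulmxA [_ *m (A^T *m _)]mulmxA -trmx_mul mulmxV // trmx1 mul1mx.
Qed.

Definition phase_layer n (a : C) (d : 'rV[bool]_n) : 'M[C]_(qdim n) :=
  mono id (fun y => \prod_q (if d 0 q && y 0 q then a else 1)).

Lemma sg_dotv n (u v : 'rV[bool]_n) : sg (dotv u v) = \prod_q sg (u 0 q && v 0 q).
Proof.
rewrite dotvE; apply: (big_morph sg) => //; exact: sgD.
Qed.

(** Qubitwise, S X = i X Z S and S Z = Z S. *)
Lemma acts_S_layer n (d : 'rV[bool]_n) :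
  acts (phase_layer i4 d) (symp_u (diag_mx d)).
Proof.
apply: acts_mono => a b.
exists (\prod_q (if d 0 q && a 0 q then i4 else 1)).
  apply/prodf_neq0 => q _; case: ifP => _; rewrite ?oner_neq0 //.
  exact: i4_neq0.
move=> v y; rewrite /v mul_row_block !simpmx row_mxKl row_mxKr; split=> //=.
rewrite !sg_dotv -!big_split; apply: eq_bigr => q _ /=.
rewrite mul_mx_diag !mxE.
have ii : i4 * i4 = -1 by rewrite -expr2 i4_sqr.
case: (d 0 q) (a 0 q) (b 0 q) (y 0 q) => [] [] [] [];
  by rewrite /sg /= ?expr1 ?expr0 ?mulr1 ?mul1r ?mulrN1 ?mulN1r ?mulrN ?mulNr ?ii ?opprK.
Qed.

End Pauli.

(** * Controlled Clifford circuits *)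

(* Hadamard gates on the qubits marked by the diagonal matrix [D]. *)
Definition symp_h (n : nat) (D : 'M[bool]_n) : 'M_(n + n) :=
  block_mx (1%:M + D) D D (1%:M + D).

Lemma symp_hM (n : nat) (D E : 'M[bool]_n) :
  symp_h D *m symp_h E = symp_h (D + E).
Proof.
rewrite mulmx_block /symp_h !mulmxDl !mulmxDr !simpmx.
have e1 : E + D *m E + (D + D *m E) = D + E.
  by rewrite addrACA addmm2 addr0 addrC.
have e2 : D + D *m E + (E + D *m E) = D + E by rewrite addrACA addmm2 addr0.
have e3 : 1%:M + E + (D + D *m E) + D *m E = 1%:M + (D + E).
  by rewrite -!addrA addmm2 addr0 [E + D]addrC.
have e4 : D *m E + (1%:M + E + (D + D *m E)) = 1%:M + (D + E).
  by rewrite addrC e3.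
by rewrite e1 e2 e3 e4.
Qed.

Lemma mul_row_delta (n : nat) (u : 'rV[bool]_n) (c t r : 'I_n) :
  (u *m delta_mx c t) 0 r = (r == t) && u 0 c.
Proof.
rewrite mxE (bigD1 c) //= mxE eqxx /= big1 ?addr0 => [|l ne].
  by case: (u 0 c); case: eqP.
by rewrite mxE (negPf ne) mulr0.
Qed.

(* Covers 150 conjugates of controlled S layers, of T-depth 9 each, a Pauli
   operator and a phase. *)
Definition clifford_cost : nat := 1400.

Section Realization.
Variable R : realType.
Local Notation C := R[i].
Local Notation w8 := (omega R).
Local Notation i4 := (Complex 0 1 : C).
Local Notation sg := (sg R).

Lemma ent_pauli_mul n (v : 'rV[bool]_(n + n)) (A : 'M[C]_(qdim n)) x z :
  ent (pauli R v *m A) x z =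
  sg (dotv (rsubmx v) (x + lsubmx v)) * ent A (x + lsubmx v) z.
Proof.
rewrite ent_mul (bigD1 (x + lsubmx v)) //= ent_mono addmK2 eqxx.
rewrite big1 ?addr0 // => y ne; rewrite ent_mono; case: eqP => [e|]; last by rewrite mul0r.
by rewrite e addmK2 eqxx in ne.
Qed.

(** H exchanges X and Z on q; the sign comes from reordering them when both are present there. *)
Lemma acts_hadamard n (q : 'I_n) :
  acts (on_qubit q (hadamard_mx R)) (symp_h (delta_mx q q)).
Proof.
move=> v; rewrite -[v]hsubmxK.
move: (lsubmx v) (rsubmx v) => a b {v}.
exists (sg (a 0 q && b 0 q)); first exact: sg_neq0.
apply: ent_inj => x z; rewrite entZ ent_mul_mono ent_pauli_mul.
rewrite mul_row_block !mulmxDr !mulmx1 !row_mxKl !row_mxKr.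
set a' := a + a *m delta_mx q q + b *m delta_mx q q.
set b' := a *m delta_mx q q + (b + b *m delta_mx q q).
have dE (u : 'rV[bool]_n) r := mul_row_delta u q q r.
have aE r : a' 0 r = if r == q then b 0 q else a 0 r.
  rewrite mxE [(a + _) _ _]mxE !dE; case: eqP => [->|_] /=; last by rewrite !addr0.
  by case: (a 0 q) (b 0 q) => [] [].
have bE r : b' 0 r = if r == q then a 0 q else b 0 r.
  rewrite mxE [(b + _) _ _]mxE !dE; case: eqP => [->|_] /=; last by rewrite add0r addr0.
  by case: (a 0 q) (b 0 q) => [] [].
clearbody a' b'; rewrite !ent_on_qubit !entry_hadamard.
have -> : [forall r, (r != q) ==> (x 0 r == (z + a) 0 r)] =
          [forall r, (r != q) ==> ((x + a') 0 r == z 0 r)].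
  apply: eq_forallb => r; case: (eqVneq r q) => //= ne.
  rewrite !mxE aE (negPf ne).
  by case: (x 0 r) (z 0 r) (a 0 r) => [] [] [].
case: ifP => [/forallP h|_]; last by rewrite mul0r !mulr0.
rewrite !sg_dotv (bigD1 q) //= [in RHS](bigD1 q) //=.
have -> : \prod_(r < n | r != q) sg (b' 0 r && (x + a') 0 r) =
          \prod_(r < n | r != q) sg (b 0 r && z 0 r).
  apply: eq_bigr => r ne; rewrite bE (negPf ne).
  by have := h r; rewrite ne => /eqP->.
move: (\prod_(r < n | r != q) _) => t.
rewrite !mxE aE bE eqxx.
by case: (x 0 q) (z 0 q) (a 0 q) (b 0 q) => [] [] [] [];
  rewrite /sg /= ?expr1 ?expr0 ?mul1r ?mulN1r ?mulrN ?mulNr ?opprK // mulrC.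
Qed.

Lemma cnot_Lin n (c t : 'I_n) : cnot_mx R c t = Lin R (1%:M + delta_mx c t).
Proof.
rewrite cnot_mxE; apply: eq_mono => y //=; apply/rowP=> r.
by rewrite mulmxDr mulmx1 mxE [in RHS]mxE mul_row_delta.
Qed.

Lemma phase_gate_layer n (q : 'I_n) (a : C) :
  on_qubit q (phase_mx a) = phase_layer a (delta_mx 0 q).
Proof.
rewrite phase_gateE; apply: eq_mono => y //.
rewrite (bigD1 q) //= mxE !eqxx /= big1 ?mulr1 // => r ne.
by rewrite mxE (negPf ne).
Qed.

Lemma unit_elem n (i j : 'I_n) :
  i != j -> (1%:M + delta_mx i j : 'M[bool]_n) \in unitmx.
Proof.
move=> ne; have [] // := @mulmx1_unit _ _ (1%:M + delta_mx i j : 'M[bool]_n) (1%:M + delta_mx i j).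
rewrite mulmxDl mul1mx mulmxDr mulmx1 mul_delta_mx_0 1?eq_sym //.
by rewrite addr0 addmK2.
Qed.

Lemma acts_gate n (g : gate n) : ~~ is_T g -> exists M, acts (gate_mx R g) M.
Proof.
case: g => // [q|q|c t ne] _; rewrite /gate_mx.
- by exists (symp_h (delta_mx q q)); apply: acts_hadamard.
- by rewrite phase_gate_layer; exists (symp_u (diag_mx (delta_mx 0 q))); apply: acts_S_layer.
- by rewrite cnot_Lin; exists (symp_d (1%:M + delta_mx c t)); apply/acts_Lin/unit_elem.
Qed.

Lemma acts_clifford n (w : circuit n) :
  clifford_circuit w -> exists M, acts (circuit_mx R w) M.
Proof.
elim: w => [_|g w IH /andP[cg /IH[M hM]]]; first by exists 1%:M; apply: acts1.
by have [N hN] := acts_gate cg; exists (M *m N); apply: acts_mul.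
Qed.

Lemma acts_inv n (K K' : 'M[C]_(qdim n)) M M' :
  K *m K' = 1%:M -> M *m M' = 1%:M -> acts K M -> acts K' M'.
Proof.
move=> KK' MM' aK v; have [s s0 e] := aK (v *m M').
exists s^-1; first by rewrite invr_eq0.
have -> : pauli R v = s^-1 *: (K *m pauli R (v *m M') *m K').
  rewrite e -mulmxA (mulmx1C MM') mulmx1 -!scalemxAl scalerA mulVf // scale1r.
  by rewrite -mulmxA KK' mulmx1.
by rewrite -scalemxAr !mulmxA (mulmx1C KK') mul1mx.
Qed.

Lemma circuit_Lin n (A : 'M[bool]_n) : A \in unitmx ->
  exists2 w, clifford_circuit w & circuit_mx R w = Lin R A.
Proof.
move/elem_gen_unit; elim=> [|i j A1 ne _ [w cw ew]].
  by exists [::]; rewrite // Lin1.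
exists (w ++ [:: GateCNOT ne]); first by rewrite clifford_cat cw.
by rewrite circuit_cat circuit1 ew LinM /gate_mx cnot_Lin.
Qed.

Lemma circuit_phase n (g : 'I_n -> gate n) a (d : 'rV[bool]_n) :
  (forall q, gate_mx R (g q) = on_qubit q (phase_mx a)) ->
  circuit_mx R [seq g q | q <- enum [pred q | d 0 q]] = phase_layer a d.
Proof.
move=> hg.
have h s : circuit_mx R [seq g q | q <- s] =
    mono id (fun y => \prod_(q <- s) (if y 0 q then a else 1)).
  elim: s => [|q s IH] /=; first by rewrite -mono1; apply: eq_mono => // y; rewrite big_nil.
  rewrite hg IH phase_gateE monoM; apply: eq_mono => // y /=.
  by rewrite big_cons.
rewrite h; apply: eq_mono => // y; rewrite big_enum big_mkcond /=.
by apply: eq_bigr => q _; rewrite inE; case: (d 0 q).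
Qed.

Lemma circuit_S_layer n (d : 'rV[bool]_n) :
  exists2 w, clifford_circuit w & circuit_mx R w = phase_layer i4 d.
Proof.
exists [seq GateS q | q <- enum [pred q | d 0 q]]; last exact: circuit_phase.
by rewrite /clifford_circuit all_map; apply/allP.
Qed.

(** Hadamard gates on all qubits: by [symp_hM] their actions combine to [symp_h 1%:M], which is
    [Omega n] because 1 + 1 = 0. *)
Lemma circuit_Omega n :
  exists2 w : circuit n, clifford_circuit w & acts (circuit_mx R w) (Omega n).
Proof.
exists [seq GateH q | q <- enum 'I_n]; first by rewrite /clifford_circuit all_map; apply/allP.
have h (s : seq 'I_n) : acts (circuit_mx R [seq GateH q | q <- s])
    (symp_h (\sum_(q <- s) delta_mx q q)).
  elim: s => [|q s IH] /=.
    by rewrite big_nil /symp_h addr0 -scalar_mx_block; apply: acts1.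
  rewrite big_cons addrC -symp_hM; apply: acts_mul => //; exact: acts_hadamard.
have := h (enum 'I_n); rewrite big_enum /=.
have -> : \sum_(q < n) delta_mx q q = 1%:M :> 'M[bool]_n.
  apply/matrixP=> i j; rewrite summxE (bigD1 i) //= !mxE eqxx big1 ?addr0 => [|l ne].
    by rewrite eq_sym; case: eqP.
  by rewrite mxE eq_sym (negPf ne).
by rewrite /symp_h addmm2.
Qed.

Lemma T_layer_phase n (g : 'I_n -> gate n) (d : 'rV[bool]_n) :
  (forall q, is_T (g q)) -> (forall q, gate_qubits (g q) = [:: q]) ->
  T_layer [seq g q | q <- enum [pred q | d 0 q]].
Proof.
move=> hT hq; rewrite /T_layer all_map; apply/andP; split; first by apply/allP=> q _; apply: hT.
rewrite -map_comp (eq_map (g := fun q => [:: q])) => [|q]; last exact: hq.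
by rewrite flatten_seq1 enum_uniq.
Qed.

Lemma costs_T_layer n (d : 'rV[bool]_n) : costs (phase_layer w8 d) 1 n.
Proof.
rewrite -(circuit_phase (g := @GateT n)) //.
apply: (costs_le (costs_layer _ (T_layer_phase _ _ _))) => //.
by rewrite size_map -cardE -[X in (_ <= X)%N]card_ord max_card.
Qed.

Lemma costs_Tdg_layer n (d : 'rV[bool]_n) : costs (phase_layer (conjc w8) d) 1 n.
Proof.
rewrite -(circuit_phase (g := @GateTdg n)) //.
apply: (costs_le (costs_layer _ (T_layer_phase _ _ _))) => //.
by rewrite size_map -cardE -[X in (_ <= X)%N]card_ord max_card.
Qed.

(** A controlled phase omega^k is the gate T^k on the control qubit. *)
Lemma costs_controlled_omega n k : (k < 8)%N ->
  costs (controlled_mx ((w8 ^+ k)%:M : 'M[C]_(qdim n))) 7 7.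
Proof.
rewrite ltnS => le; rewrite controlled_scalar -phase_gateE -phase_expr.
apply: (costs_le (D := k) (T := k)) => //.
elim: {le} k => [|k IH] /=.
  by have := @costs_clifford R n.+1 [::]; apply.
apply: (@costs_mul _ _ _ _ 1 1) => //.
by rewrite -[on_qubit _ _]mulmx1; apply: (@costs_layer _ _ [:: GateT 0]).
Qed.

Lemma costs_controlled_X n (a : 'rV[bool]_n) :
  costs (controlled_mx (pauli R (row_mx a 0))) 0 0.
Proof.
rewrite [a]matrix_sum_delta big_ord1.
apply: (big_ind (fun a => costs (controlled_mx (pauli R (row_mx a 0))) 0 0)).
- rewrite row_mx0 pauli0 controlled1.
  by have := @costs_clifford R n.+1 [::]; apply.
- move=> a1 a2 h1 h2; have := costs_controlled_mul h1 h2.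
  rewrite pauliM row_mxKl row_mxKr dotvC dotv0r scale1r.
  by rewrite add_row_mx addr0.
move=> q _; case: (a 0 q); last first.
  rewrite scale0r row_mx0 pauli0 controlled1.
  by have := @costs_clifford R n.+1 [::]; apply.
rewrite scale1r.
have -> : controlled_mx (pauli R (row_mx (delta_mx 0 q) 0)) =
    circuit_mx R [:: GateCNOT (neq_lift ord0 q)].
  rewrite circuit1 /gate_mx cnot_mxE controlled_mono.
  have lift_inj' := @lift_inj n.+1 ord0.
  apply: eq_mono => y; last by rewrite row_mxKr dotvC dotv0r; case: (y 0 0).
  rewrite row_mxKl; case: (boolP (y 0 0)) => hy.
    apply/rowP=> r; case: (unliftP ord0 r) => [l ->|->].
      by rewrite put_in // !mxE eqxx andbT (inj_eq lift_inj'); case: (l == q).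
    rewrite put_out; first by rewrite mxE (negPf (neq_lift _ _)) addr0.
    by apply/codomP=> -[l /eqP]; rewrite (negPf (neq_lift _ _)).
  by apply/rowP=> r; rewrite mxE andbF addr0.
exact: costs_clifford.
Qed.

(** On each marked qubit T X T^-1 X = diag(omega^-1, omega), which is S divided by omega. *)
Lemma S_layer_commutator n (d : 'rV[bool]_n) :
  phase_layer i4 d =
  (w8 ^+ #|[pred q | d 0 q]|)%:M *m
  (phase_layer w8 d *m pauli R (row_mx d 0) *m phase_layer (conjc w8) d *m
   pauli R (row_mx d 0)).
Proof.
move: (conjc w8) (omega_conj R) (omega_sqr R) => wc e e2.
rewrite mul_scalar_mx !monoM monoZ; apply: eq_mono => y /=.
  by rewrite row_mxKl addmK2.
rewrite row_mxKr row_mxKl dotvC dotv0r dotvC dotv0r !mulr1 -prodr_const.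
rewrite [X in X * _]big_mkcond -!big_split /=; apply: eq_bigr => q _; rewrite !mxE.
by rewrite inE; case: (d 0 q) (y 0 q) => [] [] //=; rewrite ?mul1r ?mulr1.
Qed.

Lemma costs_controlled_S_layer n (d : 'rV[bool]_n) :
  costs (controlled_mx (phase_layer i4 d)) 9 (n + n + 7).
Proof.
have TT : phase_layer w8 d *m phase_layer (conjc w8) d = 1%:M.
  rewrite monoM -mono1; apply: eq_mono => // y /=; rewrite -big_split big1 //= => q _.
  by case: ifP; rewrite ?mulr1 // omega_conj.
rewrite S_layer_commutator.
set k := #|_|; have -> : w8 ^+ k = w8 ^+ (k %% 8).
  by rewrite {1}(divn_eq k 8) exprD mulnC exprM omega_expr8 expr1n mul1r.
rewrite -[9%N]/(7 + 2)%N [(_ + 7)%N]addnC; apply: costs_controlled_mul.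
  by apply: costs_controlled_omega; rewrite ltn_mod.
rewrite -[2%N]addn0 -[(n + n)%N]addn0; apply: costs_controlled_mul; last exact: costs_controlled_X.
rewrite controlled_conj //.
have lift_inj' := @lift_inj n.+1 ord0.
have hT := costs_emb lift_inj' (costs_T_layer d).
have hTdg := costs_emb lift_inj' (costs_Tdg_layer d).
by have := costs_mul (costs_mul hT (costs_controlled_X d)) hTdg; rewrite !addn0.
Qed.

(** The X part is controlled by CNOT gates, and the Z part is an S layer applied twice. *)
Lemma costs_controlled_pauli n (v : 'rV[bool]_(n + n)) :
  costs (controlled_mx (pauli R v)) 18 (2 * (n + n + 7)).
Proof.
have -> : pauli R v = pauli R (row_mx (lsubmx v) 0) *m
    (phase_layer i4 (rsubmx v) *m phase_layer i4 (rsubmx v)).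
  have := pauliM R (row_mx (lsubmx v) 0) (row_mx 0 (rsubmx v)).
  rewrite row_mxKr row_mxKl dotv0r scale1r add_row_mx addr0 add0r hsubmxK => <-.
  congr (_ *m _); rewrite monoM; apply: eq_mono => y /=.
    by rewrite row_mxKl addr0.
  rewrite row_mxKr sg_dotv -big_split; apply: eq_bigr => q _ /=.
  by case: ifP => _; rewrite ?mulr1 // -expr2 i4_sqr.
rewrite -[18%N]add0n -[(2 * _)%N]add0n.
apply: costs_controlled_mul; first exact: costs_controlled_X.
by rewrite mul2n -addnn; apply: (@costs_controlled_mul _ _ _ _ 9 _ 9);
  apply: costs_controlled_S_layer.
Qed.

(** Only the action on Pauli operators is prescribed, so any circuit with that action may be chosen.
    [k] counts controlled S layers, each of T-depth 9 and T-count 2n + 7. *)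
Definition cheap k n (M : 'M[bool]_(n + n)) : Prop :=
  exists2 w : circuit n, clifford_circuit w &
    acts (circuit_mx R w) M /\
    costs (controlled_mx (circuit_mx R w)) (k * 9) (k * (n + n + 7)).

Lemma cheap_mul k l n (M N : 'M[bool]_(n + n)) :
  cheap k M -> cheap l N -> cheap (k + l) (M *m N).
Proof.
move=> [w cw [aw hw]] [w' cw' [aw' hw']]; exists (w' ++ w).
  by rewrite clifford_cat cw' cw.
rewrite circuit_cat; split; first exact: acts_mul.
by rewrite !mulnDl [X in costs _ X]addnC [X in costs _ _ X]addnC; apply: costs_controlled_mul.
Qed.

Lemma cheap_conj k n (w : circuit n) (M N N' : 'M[bool]_(n + n)) :
  clifford_circuit w -> acts (circuit_mx R w) N -> N *m N' = 1%:M ->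
  cheap k M -> cheap k (N' *m M *m N).
Proof.
move=> cw aN NN' [k0 ck [ak hk]].
have [w' cw' ww'] := clifford_inv R cw.
exists (w ++ k0 ++ w'); first by rewrite !clifford_cat cw ck.
rewrite !circuit_cat mulmxA; split; last exact: costs_conj.
rewrite -[N' *m M *m N]mulmxA; apply: acts_mul; first exact: acts_mul.
exact: acts_inv ww' NN' aN.
Qed.

Lemma cheap_diag n (d : 'rV[bool]_n) : cheap 1 (symp_u (diag_mx d)).
Proof.
have [w cw ew] := circuit_S_layer d; exists w => //; rewrite ew !mul1n.
by split; [exact: acts_S_layer|exact: costs_controlled_S_layer].
Qed.

(** Write X = M 1 M^T + diagonal: the first term is S on every qubit conjugated by a CNOT circuit,
    the second is an S layer, hence two layers. *)
Lemma cheap_u n (X : 'M[bool]_n) : X^T = X -> cheap 2 (symp_u X).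
Proof.
move=> /sym_gram_diag[M [d [uM ->]]]; rewrite symp_uD.
apply: (@cheap_mul 1 1); last exact: cheap_diag.
have iM := uni_trig_unit uM; have iM' : invmx M \in unitmx by rewrite unitmx_inv.
rewrite -[M in M *m _]mulmx1 symp_du //.
have [w cw ew] := circuit_Lin iM'.
apply: cheap_conj cw _ _ _; first by rewrite ew; apply: acts_Lin.
  rewrite -symp_dM // mulVmx // /symp_d invmx1 trmx1.
  by rewrite -scalar_mx_block.
have -> : 1%:M = diag_mx (const_mx 1) :> 'M[bool]_n by rewrite diag_const_mx.
exact: cheap_diag.
Qed.

Lemma OmegaK n : Omega n *m Omega n = 1%:M.
Proof. by rewrite mulmx_block !simpmx -scalar_mx_block. Qed.

Lemma cheap_l n (X : 'M[bool]_n) : X^T = X -> cheap 2 (symp_l X).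
Proof.
move=> sX; rewrite Omega_lu; have [w cw aw] := circuit_Omega n.
by apply: cheap_conj cw aw _ (cheap_u sX); apply: OmegaK.
Qed.

Lemma cheap_Omega n : cheap 6 (Omega n).
Proof.
rewrite Omega_lul; apply: (@cheap_mul 4 2); last by apply: cheap_u; rewrite trmx1.
by apply: (@cheap_mul 2 2); [apply: cheap_u|apply: cheap_l]; rewrite trmx1.
Qed.

Lemma cheap_d_sym n (A : 'M[bool]_n) : A^T = A -> A \in unitmx -> cheap 12 (symp_d A).
Proof.
move=> sA uA; rewrite symp_d_sym //; apply: (@cheap_mul 6 6); last exact: cheap_Omega.
apply: (@cheap_mul 4 2); last exact: cheap_u.
by apply: (@cheap_mul 2 2); [apply: cheap_u|apply: cheap_l; rewrite trmx_inv sA].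
Qed.

Lemma cheap_d n (A : 'M[bool]_n) : A \in unitmx -> cheap 144 (symp_d A).
Proof.
have h k (B : 'M[bool]_n) : sym_prod k B -> cheap (12 * k) (symp_d B); last first.
  by move/unitmx_sym_prod/h.
elim=> [A1 sA uA|k1 l A1 B1 pA IA pB IB].
  by rewrite muln1; apply: cheap_d_sym.
rewrite mulnDr symp_dM ?(sym_prod_unit pA) ?(sym_prod_unit pB) //.
exact: cheap_mul.
Qed.

Lemma cheap_symplectic n (M : 'M[bool]_(n + n)) : symplectic M -> cheap 150 M.
Proof.
case/symplectic_decomp=> A [X [Y [Z [uA sX sY sZ ->]]]].
apply: (@cheap_mul 148 2); last exact: cheap_l.
apply: (@cheap_mul 146 2); last exact: cheap_u.
by apply: (@cheap_mul 2 144); [apply: cheap_l|apply: cheap_d].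
Qed.

(** The given circuit and a cheap one with the same symplectic action differ by a Pauli operator and
    a phase; each of the three factors is controlled separately. *)
Lemma costs_controlled_clifford n (w : circuit n) : clifford_circuit w ->
  costs (controlled_mx (circuit_mx R w)) clifford_cost (clifford_cost * n.+1).
Proof.
move=> cw; have [w' _ ww'] := clifford_inv R cw.
have [M aM] := acts_clifford cw.
have [k ck [ak hk]] := cheap_symplectic (acts_symplectic ww' aM).
have [k' ck' kk'] := clifford_inv R ck.
have [a [u hu]] := acts_uniq ww' kk' aM ak.
have hau : circuit_mx R (k' ++ w) = a *: pauli R u.
  by rewrite circuit_cat hu -scalemxAr mulmxA (mulmx1C kk') mul1mx.
have [j lt_j ea] : exists2 j, (j < 8)%N & a = w8 ^+ j.
  (* The exponent is 16: the square of a P_u is a scalar circuit, equal to a^2 up to sign, so a^2 is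
     an eighth root of unity. The entry of a P_u in column 0 shows that a lies in Q(omega). *)
  apply: (inQw_omega_power (k := 1)).
    have := inQw_circuit R (k' ++ w) (lsubmx u) 0; rewrite hau entZ ent_mono.
    by rewrite add0r eqxx dotv0r /sg mulr1.
  have : circuit_mx R ((k' ++ w) ++ (k' ++ w)) =
      (a ^+ 2 * sg (dotv (rsubmx u) (lsubmx u)))%:M.
    rewrite circuit_cat hau -scalemxAl -scalemxAr scalerA pauli_sqr.
    by rewrite scale_scalar_mx.
  case/scalar_circuit=> l _ /(congr1 (fun x => x ^+ 8)).
  rewrite [X in _ = X -> _]exprAC omega_expr8 expr1n exprMn -exprM => <-.
  by rewrite (exprM _ 2 4) expr2 sgK expr1n mulr1.
have -> : circuit_mx R w = (w8 ^+ j)%:M *m (circuit_mx R k *m pauli R u).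
  by rewrite mul_scalar_mx hu ea.
apply: (costs_le (D := 7 + (150 * 9 + 18))
                 (T := 7 + (150 * (n + n + 7) + 2 * (n + n + 7)))) => //.
- apply: costs_controlled_mul; first exact: costs_controlled_omega.
  by apply: costs_controlled_mul => //; apply: costs_controlled_pauli.
- by rewrite -mulnDl /clifford_cost; lia.
Qed.

End Realization.

(** * The controlled T gate *)

Section ControlledT.
Variable R : realType.
Local Notation C := R[i].
Local Notation w8 := (omega R).
Local Notation i4 := (Complex 0 1 : C).
Local Notation sg := (sg R).

Definition flip n (i j k : 'I_n) (y : 'rV[bool]_n) : 'rV[bool]_n :=
  \row_r (y 0 r + ((r == k) && (y 0 i && y 0 j))).

Lemma flipE n (i j k : 'I_n) y r :
  flip i j k y 0 r = y 0 r + ((r == k) && (y 0 i && y 0 j)).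
Proof. exact: mxE. Qed.

Definition tof n (i j k : 'I_n) : 'M[C]_(qdim n) := mono (flip i j k) (fun=> 1).

Definition ccz n (i j k : 'I_n) : 'M[C]_(qdim n) :=
  mono id (fun y => sg (y 0 i && (y 0 j && y 0 k))).

Lemma put_res m n (f : 'I_m -> 'I_n) y : injective f -> put f (res f y) y = y.
Proof.
by move=> f_inj; apply/esym/eqP; rewrite eq_put // eqxx andbT; apply/agreeP.
Qed.

Lemma emb_diag m n (f : 'I_m -> 'I_n) (phi : 'rV[bool]_m -> C) : injective f ->
  emb f (mono id phi) = mono id (phi \o res f).
Proof. by move=> f_inj; rewrite emb_mono //; apply: eq_mono => // y; apply: put_res. Qed.

Lemma emb_tof m n (f : 'I_m -> 'I_n) i j k : injective f ->
  emb f (tof i j k) = tof (f i) (f j) (f k).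
Proof.
move=> f_inj; rewrite emb_mono //; apply: eq_mono => // y.
apply/rowP=> r; case: (boolP (r \in codom f)) => [/codomP[q ->]|hr].
  by rewrite put_in // !mxE (inj_eq f_inj).
rewrite put_out // mxE; case: eqP => [e|_]; last by rewrite addr0.
by rewrite e codom_f in hr.
Qed.

Lemma controlled_cnot n (c t : 'I_n) :
  controlled_mx (cnot_mx R c t) = tof ord0 (lift ord0 c) (lift ord0 t).
Proof.
have lift_inj' := @lift_inj n.+1 ord0.
rewrite cnot_mxE controlled_mono; apply: eq_mono => y; last by case: (y 0 0).
apply/rowP=> r; rewrite [RHS]mxE; case: (boolP (y 0 0)) => hy; last first.
  by rewrite andbF addr0.
case: (unliftP ord0 r) => [l ->|->]; first by rewrite put_in // !mxE (inj_eq lift_inj').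
rewrite put_out ?(negPf (neq_lift _ _)) ?addr0 //.
by apply/codomP=> -[l /eqP]; rewrite (negPf (neq_lift _ _)).
Qed.

Lemma three_inj n (i j k : 'I_n) :
  uniq [:: i; j; k] -> injective (tnth [tuple i; j; k]).
Proof. by move=> h; apply/tuple_uniqP. Qed.

(** A Toffoli gate is a controlled two-qubit Clifford, built on its three qubits alone, so the cost
    is constant. *)
Lemma costs_tof n (i j k : 'I_n) : uniq [:: i; j; k] ->
  costs (tof i j k) clifford_cost (clifford_cost * 3).
Proof.
move=> hu; have f_inj := three_inj hu.
have -> : tof i j k = emb (tnth [tuple i; j; k])
    (controlled_mx (cnot_mx R (0 : 'I_2) 1)).
  by rewrite controlled_cnot emb_tof //; congr tof; rewrite (tnth_nth i).
apply: costs_emb => //.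
have ne : (0 : 'I_2) != 1 by [].
by have := @costs_controlled_clifford R 2 [:: GateCNOT ne] isT; rewrite circuit1.
Qed.

Lemma costs_ccz n (i j k : 'I_n) : uniq [:: i; j; k] ->
  costs (ccz i j k) clifford_cost (clifford_cost * 3).
Proof.
move=> hu; have f_inj := three_inj hu.
have ne : (0 : 'I_2) != 1 by [].
(* The controlled Z gate: the phase is i^(a + b - (a xor b)) = (-1)^(a b). *)
pose w := [:: GateS 0; GateS 1; GateCNOT ne; GateS 1; GateS 1; GateS 1; GateCNOT ne].
have hw : circuit_mx R w = mono id (fun y => sg (y 0 0 && y 0 1)).
  rewrite /w /= mulmx1 !phase_gateE !cnot_mxE !monoM; apply: eq_mono => y /=.
    apply/rowP=> r; rewrite !mxE /= addr0 -addrA.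
    by case: (y 0 r) (r == 1) (y 0 0) => [] [] [].
  rewrite !mxE /=.
  have ii : i4 * i4 = -1 by rewrite -expr2 i4_sqr.
  by case: (y 0 0) (y 0 1) => [] []; rewrite /sg /= ?mulr1 ?mul1r ?ii ?mulrN1 ?mulrN ?ii ?opprK.
have -> : ccz i j k = emb (tnth [tuple i; j; k]) (controlled_mx (circuit_mx R w)).
  rewrite hw controlled_mono emb_mono //; apply: eq_mono => y /=.
    rewrite (fun_if (put _ ^~ y)) !put_res //.
      by rewrite if_same.
    exact: lift_inj.
  rewrite !mxE !(tnth_nth i) /=.
  by case: (y 0 i).
by apply: costs_emb => //; apply: (@costs_controlled_clifford R 2 w).
Qed.

Lemma costs_T_gate n (q : 'I_n) : costs (on_qubit q (phase_mx w8)) 1 1.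
Proof. by have := @costs_layer R n [:: GateT q] isT; rewrite circuit1. Qed.

Lemma costs_Tdg_gate n (q : 'I_n) : costs (on_qubit q (phase_mx (conjc w8))) 1 1.
Proof. by have := @costs_layer R n [:: GateTdg q] isT; rewrite circuit1. Qed.

Lemma costs_S_gate n (q : 'I_n) : costs (on_qubit q (phase_mx i4)) 0 0.
Proof. by have := @costs_clifford R n [:: GateS q] isT; rewrite circuit1. Qed.

(** The exponents of omega telescope: xy(1 - 2z) + 2xyz(1 - 2w) + 4xyzw = xy. There are 2 + 8 + 4 =
    14 Toffoli or CCZ gates, of T-count at most 3 [clifford_cost] each, and two T gates. *)
Lemma costs_cphase_T n (x y z w v : 'I_n) : uniq [:: x; y; z; w; v] ->
  costs (mono id (fun u => if u 0 x && u 0 y then w8 else 1)) 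
    (14 * clifford_cost + 2)%N (42 * clifford_cost + 2)%N.
Proof.
move=> hu.
have [hxy hxz hxw hxv] : [/\ x != y, x != z, x != w & x != v].
  by move: hu; rewrite /= !inE !negb_or => /andP[/and4P[]].
have [hyz hyw hyv hzw] : [/\ y != z, y != w, y != v & z != w].
  by move: hu; rewrite /= !inE !negb_or => /and5P[_ /and3P[? ? ?] /andP[? ?] _ _].
have [hzv hwv] : z != v /\ w != v.
  by move: hu; rewrite /= !inE !negb_or => /and5P[_ _ /andP[_ ?] ? _].
(* [B] adds [x && y && z] to [w], borrowing [v]; the phases of [T1], [T2] and
   [T3] are omega^(x y (1 - 2 z)), i^(x y z (1 - 2 w)) and (-1)^(x y z w). *)
pose T1 := on_qubit z (phase_mx (conjc w8)) *m tof x y z *m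
  on_qubit z (phase_mx w8) *m tof x y z.
pose B := tof x y v *m tof v z w *m tof x y v *m tof v z w.
pose S := on_qubit w (phase_mx i4).
pose T2 := S *m S *m S *m B *m S *m B.
pose T3 := tof x y v *m ccz v z w *m tof x y v *m ccz v z w.
have eB : B = mono (fun u => \row_r (u 0 r + ((r == w) && (u 0 x && (u 0 y && u 0 z))))) (fun=> 1).
  rewrite /B !monoM; apply: eq_mono => u /=; last by rewrite !mulr1.
  apply/rowP=> r; rewrite !mxE.
  rewrite (negPf hxw) (negPf hxv) (negPf hyw) (negPf hyv) (negPf hzw) (negPf hzv).
  rewrite ?eqxx /=.
  rewrite [v == w]eq_sym (negPf hwv) /= !addr0.
  have rvw : ~~ ((r == v) && (r == w)).
    by apply/negP=> /andP[/eqP-> /eqP e]; rewrite e eqxx in hwv.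
  case: (r == v) rvw; case: (r == w) => //= _; case: (u 0 x); case: (u 0 y);
    case: (u 0 z); case: (u 0 v); by case: (u 0 r).
(* Exponents of omega as natural numbers, with 7 and 6 standing for -1 and -2 modulo 8. For bits, (a
   xor t) - a = t (1 - 2a). *)
pose e1 (a b c : bool) := ((a (+) (b && c)) + 7 * a)%N.
pose e2 (a b c d : bool) := (2 * (a (+) (b && (c && d))) + 6 * a)%N.
pose e3 (a b c d : bool) := (4 * (b && (c && (d && a))))%N.
have pw k (b : bool) : (if b then w8 ^+ k else 1) = w8 ^+ (k * b).
  by case: b; rewrite ?muln1 ?muln0.
have pw1 (b : bool) : (if b then w8 else 1) = w8 ^+ b by case: b.
have eT1 : T1 = mono id (fun u => w8 ^+ e1 (u 0 z) (u 0 x) (u 0 y)).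
  rewrite /T1 omega_conjE !phase_gateE !monoM; apply: eq_mono => u /=.
    apply/rowP=> r; rewrite !flipE (negPf hxz) (negPf hyz) /= !addr0 -addrA.
    by rewrite [X in _ + X](_ : _ = 0) ?addr0 //; case: (_ && _).
  rewrite !flipE (negPf hxz) (negPf hyz) !eqxx /= !addr0 !mulr1.
  rewrite !pw !pw1 -!exprD; congr (_ ^+ _).
  by case: (u 0 z); case: (u 0 x); case: (u 0 y).
have eT2 : T2 = mono id
    (fun u => w8 ^+ e2 (u 0 w) (u 0 x) (u 0 y) (u 0 z)).
  rewrite /T2 eB /S !phase_gateE !monoM; apply: eq_mono => u /=.
    apply/rowP=> r; rewrite !mxE (negPf hxw) (negPf hyw) (negPf hzw) /= !addr0 -addrA.
    by rewrite [X in _ + X](_ : _ = 0) ?addr0 //; case: (_ && _).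
  rewrite !mxE (negPf hxw) (negPf hyw) (negPf hzw) !eqxx /= !addr0 !mulr1.
  rewrite -omega_sqr !pw -!exprD; congr (_ ^+ _).
  by case: (u 0 w); case: (u 0 x); case: (u 0 y); case: (u 0 z).
have eT3 : T3 = mono id
    (fun u => w8 ^+ e3 (u 0 w) (u 0 x) (u 0 y) (u 0 z)).
  rewrite /T3 !monoM; apply: eq_mono => u /=.
    apply/rowP=> r; rewrite !flipE (negPf hxv) (negPf hyv) /= !addr0 -addrA.
    by rewrite [X in _ + X](_ : _ = 0) ?addr0 //; case: (_ && _).
  rewrite !flipE ?(negPf hxv) ?(negPf hyv) ?(negPf hzv) ?(negPf hwv) !eqxx /= !addr0 !mulr1 !mul1r.
  rewrite -sgD -pw omega_expr4.
  by case: (u 0 w); case: (u 0 x); case: (u 0 y); case: (u 0 z); case: (u 0 v).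
have -> : mono id (fun u => if u 0 x && u 0 y then w8 else 1) = T1 *m T2 *m T3 :> 'M_(qdim n).
  rewrite eT1 eT2 eT3 !monoM; apply: eq_mono => u //=; rewrite -!exprD.
  have omod a b : a = b %[mod 8] -> w8 ^+ a = w8 ^+ b.
    move=> e; rewrite (divn_eq a 8) (divn_eq b 8) e !exprD !(mulnC _ 8).
    by rewrite !(exprM _ 8) omega_expr8 !expr1n.
  rewrite (omod _ (u 0 x && u 0 y)); first by case: (_ && _).
  by case: (u 0 w); case: (u 0 x); case: (u 0 y); case: (u 0 z).
have uxyz : uniq [:: x; y; z] by rewrite /= !inE negb_or hxy hxz hyz.
have uxyv : uniq [:: x; y; v] by rewrite /= !inE negb_or hxy hxv hyv.
have uvzw : uniq [:: v; z; w] by rewrite /= !inE negb_or eq_sym hzv eq_sym hwv hzw.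
have cA := costs_tof uxyz; have cV := costs_tof uxyv.
have cW := costs_tof uvzw; have cZ := costs_ccz uvzw.
have cB := costs_mul (costs_mul (costs_mul cV cW) cV) cW.
have cS := costs_S_gate w.
have c1 := costs_mul (costs_mul (costs_mul (costs_Tdg_gate z) cA) (costs_T_gate z)) cA.
have c2 := costs_mul (costs_mul (costs_mul (costs_mul (costs_mul cS cS) cS) cB) cS) cB.
have c3 := costs_mul (costs_mul (costs_mul cV cZ) cV) cZ.
have c4 := costs_mul (costs_mul c1 c2) c3.
by apply: costs_le c4 _ _; move: clifford_cost => k; clear; lia.
Qed.

End ControlledT.

(** * Controlled T layers *)

Section ControlledLayer.
Variable R : realType.
Local Notation C := R[i].
Local Notation w8 := (omega R).
Local Notation i4 := (Complex 0 1 : C).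
Local Notation cc := clifford_cost.

Lemma four_others n (q : 'I_n) : (4 <= n)%N ->
  exists z w v : 'I_n, uniq [:: q; z; w; v].
Proof.
move=> le4; have : (3 <= size (enum (predC1 q)))%N.
  by rewrite -cardE cardC1 card_ord -ltnS prednK // (leq_trans _ le4).
have := enum_uniq (predC1 q); have : q \notin enum (predC1 q) by rewrite mem_enum inE eqxx.
case: (enum _) => [|z [|w [|v s]]] // hq hu _; exists z, w, v.
move: hq hu; rewrite -[_ :: _]/([:: z; w; v] ++ s) mem_cat negb_or => /andP[hq _].
by rewrite cat_uniq => /andP[hu _]; rewrite cons_uniq hq.
Qed.

(** The five qubits are the control, q and three borrowed ones, all within the n + 1 available. *)
Lemma costs_controlled_T n (q : 'I_n) : (4 <= n)%N ->
  costs (controlled_mx (on_qubit q (phase_mx w8)))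
    (14 * cc + 2)%N (42 * cc + 2)%N.
Proof.
move=> le4; have [z [w [v hu]]] := four_others q le4.
have lift_inj' := @lift_inj n.+1 ord0.
have -> : controlled_mx (on_qubit q (phase_mx w8)) =
    mono id (fun u => if u 0 ord0 && u 0 (lift ord0 q) then w8 else 1).
  rewrite phase_gateE controlled_mono; apply: eq_mono => u /=.
    by rewrite put_res // if_same.
  by rewrite mxE; case: (u 0 0).
apply: (@costs_cphase_T _ _ _ _ (lift ord0 z) (lift ord0 w) (lift ord0 v)).
rewrite -[_ :: _]/(ord0 :: map (lift ord0) [:: q; z; w; v]) cons_uniq.
rewrite (map_inj_uniq lift_inj') hu andbT.
by apply/mapP=> -[l _ /eqP]; rewrite (negPf (neq_lift _ _)).
Qed.

(** T^-1 = T S^3, and the controlled S^3 is a controlled one-qubit Clifford. *)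
Lemma costs_controlled_T_gate n (g : gate n) : (4 <= n)%N -> is_T g ->
  costs (controlled_mx (gate_mx R g)) (15 * cc + 2)%N (44 * cc + 2)%N.
Proof.
move=> le4; case: g => // q _; rewrite /gate_mx.
  by apply: costs_le (costs_controlled_T q le4) _ _; move: cc => k; clear; lia.
have f_inj : injective (fun _ : 'I_1 => q) by move=> x y; rewrite !ord1.
have -> : on_qubit q (phase_mx (conjc w8)) = on_qubit q (phase_mx w8) *m
    emb (fun _ : 'I_1 => q) (circuit_mx R (nseq 3 (GateS 0))).
  rewrite iter_gate /gate_mx phase_expr emb_on_qubit // !phase_gateE monoM.
  rewrite omega_conjE; apply: eq_mono => // y /=.
  by case: ifP; rewrite ?mulr1 // -omega_sqr -exprM -exprS.
have h := costs_controlled_clifford R (w := nseq 3 (GateS (0 : 'I_1))) isT.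
have := costs_emb (lift_emb_inj f_inj) h; rewrite -controlled_emb // => h'.
by apply: costs_le (costs_controlled_mul (costs_controlled_T q le4) h') _ _;
  move: cc => k; clear; lia.
Qed.

Definition T_phase (b : bool) : C := if b then conjc w8 else w8.

Definition T_diag m (s : 'I_m -> bool) : 'M[C]_(qdim m) :=
  mono id (fun u => \prod_j (if u 0 j then T_phase (s j) else 1)).

Lemma phase_row k (d e a b : 'rV[bool]_k) (z : C) :
  \prod_q (if row_mx d e 0 q && row_mx a b 0 q then z else 1) =
  \prod_q (if d 0 q && a 0 q then z else 1) *
  \prod_q (if e 0 q && b 0 q then z else 1).
Proof.
rewrite big_split_ord; congr (_ * _); apply: eq_bigr => q _.
  by rewrite !row_mxEl.
by rewrite !row_mxEr.
Qed.

(* Exchanging the two halves conjugates T to T on the other half, so T on one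
   half and T^-1 on the other is a commutator of T gates with a Clifford. *)
Lemma T_diag_swap k (s : 'I_(k + k) -> bool) :
  T_diag s =
  phase_layer w8 (row_mx (const_mx true) 0) *m Lin R (Omega k) *m
  phase_layer (conjc w8) (row_mx (const_mx true) 0) *m Lin R (Omega k) *m
  (phase_layer i4 (row_mx 0 (\row_j ~~ s (rshift k j))) *m
   (phase_layer i4 (row_mx (\row_j s (lshift k j)) 0) *m
    phase_layer i4 (row_mx (\row_j s (lshift k j)) 0) *m
    phase_layer i4 (row_mx (\row_j s (lshift k j)) 0))).
Proof.
rewrite omega_conjE !monoM; apply: eq_mono => u /=.
  by rewrite -mulmxA OmegaK mulmx1.
rewrite -[u]hsubmxK; move: (lsubmx u) (rsubmx u) => a b {u}.
rewrite mul_row_block !simpmx mul_row_block !simpmx !phase_row big_split_ord /=.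
have h0 (v : 'rV[bool]_k) (z : C) : \prod_q (if (0 : 'rV[bool]_k) 0 q && v 0 q then z else 1) = 1.
  by rewrite big1 // => q _; rewrite mxE.
rewrite !h0 !mulr1 !mul1r.
(* The commutator puts T on the left half and T^-1 on the right half. S^3 turns T into T^-1 where
   [s] holds on the left; S turns T^-1 into T where [s] fails on the right. *)
have -> : \prod_(i < k) (if row_mx a b 0 (lshift k i) then T_phase (s (lshift k i)) else 1) =
    \prod_q (if (const_mx true : 'rV_k) 0 q && a 0 q then w8 else 1) *
    ((\prod_q (if (\row_j s (lshift k j)) 0 q && a 0 q then i4 else 1) *
    \prod_q (if (\row_j s (lshift k j)) 0 q && a 0 q then i4 else 1)) *
    \prod_q (if (\row_j s (lshift k j)) 0 q && a 0 q then i4 else 1)).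
  rewrite -!big_split; apply: eq_bigr => q _; rewrite row_mxEl !mxE /= /T_phase.
  case: (a 0 q); rewrite ?andbT ?andbF ?mulr1 //.
  case: (s _); rewrite ?mulr1 // omega_conjE -omega_sqr.
  by rewrite -!exprD -exprS.
have -> : \prod_(i < k) (if row_mx a b 0 (rshift k i) then T_phase (s (rshift k i)) else 1) =
    \prod_q (if (const_mx true : 'rV_k) 0 q && b 0 q then w8 ^+ 7 else 1) *
    \prod_q (if (\row_j ~~ s (rshift k j)) 0 q && b 0 q then i4 else 1).
  rewrite -!big_split; apply: eq_bigr => q _; rewrite row_mxEr !mxE /= /T_phase.
  case: (b 0 q); rewrite ?andbT ?andbF ?mulr1 //.
  case: (s _); rewrite ?mulr1 ?omega_conjE // -omega_sqr -exprD.
  by rewrite (exprD _ 8 1) omega_expr8 mul1r.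
set p1 := \prod_q _; set p2 := \prod_q _; set p3 := \prod_q _; set p4 := \prod_q _.
ring.
Qed.

(** The two T layers conjugate a controlled exchange and stay uncontrolled, giving the summand 2.
    The two exchanges and the S corrections are three controlled Cliffords on m qubits. *)
Lemma costs_controlled_T_diag m (s : 'I_m -> bool) : ~~ odd m ->
  costs (controlled_mx (T_diag s)) (3 * cc + 2)%N ((3 * cc + 2) * m.+1)%N.
Proof.
move=> ev; have : m = (m./2 + m./2)%N by rewrite addnn even_halfK.
move: m./2 => k e; move: s ev; rewrite {m}e => s _.
have lift_inj' := @lift_inj (k + k).+1 ord0.
set d : 'rV[bool]_(k + k) := row_mx (const_mx true) 0.
have TT : phase_layer w8 d *m phase_layer (conjc w8) d = 1%:M.
  rewrite monoM -mono1; apply: eq_mono => // y /=; rewrite -big_split big1 //= => q _.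
  by case: ifP; rewrite ?mulr1 // omega_conj.
have [w cw ew] : exists2 w, clifford_circuit w & circuit_mx R w = Lin R (Omega k).
  by apply: circuit_Lin; have [] := mulmx1_unit (OmegaK k).
have cO := costs_controlled_clifford R cw; rewrite ew in cO.
have [w1 cw1 ew1] := circuit_S_layer R (row_mx (0 : 'rV_k) (\row_j ~~ s (rshift k j))).
have [w2 cw2 ew2] := circuit_S_layer R (row_mx (\row_j s (lshift k j)) (0 : 'rV_k)).
have cS : costs (controlled_mx (circuit_mx R (w1 ++ (w2 ++ w2) ++ w2))) cc (cc * (k + k).+1)%N.
  by apply: costs_controlled_clifford; rewrite !clifford_cat cw1 cw2.
rewrite T_diag_swap -/d -ew1 -ew2 -!circuit_cat.
have c1 := costs_mul (costs_mul (costs_emb lift_inj' (costs_T_layer R d)) cO)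
             (costs_emb lift_inj' (costs_Tdg_layer R d)).
rewrite -controlled_conj // in c1.
apply: costs_le (costs_controlled_mul (costs_controlled_mul c1 cO) cS) _ _;
  move: cc => c; clear.
  by lia.
by nia.
Qed.

Definition is_Tdg n (g : gate n) : bool :=
  if g is GateTdg _ then true else false.

Lemma circuit_T_gates n (q0 : 'I_n) (l : circuit n) : all (@is_T n) l ->
  circuit_mx R l = mono id (fun y =>
    \prod_(g <- l) (if y 0 (head q0 (gate_qubits g)) then T_phase (is_Tdg g) else 1)).
Proof.
elim: l => [_|g l IH /= /andP[hg /IH->]].
  by rewrite /= -mono1; apply: eq_mono => // y; rewrite big_nil.
have -> : gate_mx R g = mono id (fun y =>
    if y 0 (head q0 (gate_qubits g)) then T_phase (is_Tdg g) else 1).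
  by case: g hg => // q _; rewrite -phase_gateE.
by rewrite monoM; apply: eq_mono => // y; rewrite big_cons.
Qed.

(** An even layer is viewed as an operator on its own qubits, so the T-count is linear in its size;
    in an odd layer one gate is split off and controlled by itself. *)
Lemma costs_controlled_layer n (l : circuit n) : (4 <= n)%N -> T_layer l ->
  costs (controlled_mx (circuit_mx R l)) (50 * cc + 4)%N ((50 * cc + 4) * size l)%N.
Proof.
move=> le4; have q0 : 'I_n := Ordinal (leq_trans (isT : (0 < 4)%N) le4).
have even_layer (l' : circuit n) : T_layer l' -> ~~ odd (size l') ->
    costs (controlled_mx (circuit_mx R l')) (3 * cc + 2)%N ((3 * cc + 2) * (size l').+1)%N.
  case/andP=> hT hu ev.
  pose tq (g : gate n) := head q0 (gate_qubits g).
  have f_inj : injective (tnth (map_tuple tq (in_tuple l'))).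
    apply/tuple_uniqP; rewrite /=; move: hu.
    have -> // : flatten [seq gate_qubits g | g <- l'] = [seq tq g | g <- l'].
    elim: l' hT {ev} => //= g l' IH /andP[hg /IH->].
    by case: g hg.
  have -> : circuit_mx R l' = emb (tnth (map_tuple tq (in_tuple l')))
      (T_diag (fun j => is_Tdg (tnth (in_tuple l') j))).
    rewrite (circuit_T_gates q0 hT) emb_diag //; apply: eq_mono => // y /=.
    rewrite big_tnth; apply: eq_bigr => j _; rewrite mxE tnth_map.
    by [].
  rewrite controlled_emb //; apply: costs_emb; first exact: lift_emb_inj.
  exact: costs_controlled_T_diag.
move=> hl; case: (boolP (odd (size l))) => [od|ev].
  case: l hl od => // g l /andP[/= /andP[hg hl] hu]; rewrite /= => od.
  have hl' : T_layer l by rewrite /T_layer hl; move: hu; rewrite cat_uniq => /and3P[].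
  have := costs_controlled_mul (costs_controlled_T_gate le4 hg) (even_layer _ hl' od).
  move/costs_le; apply; move: cc (size l) => c m; clear; first lia.
  by nia.
(* The bound for the empty layer is T-count 0, which the general even bound, with its
   [(size l').+1], does not give. *)
case: l hl ev => [_ _|g l hl ev].
  by rewrite controlled1; apply: costs_le (@costs_clifford R n.+1 [::] isT) _ _.
apply: costs_le (even_layer _ hl ev) _ _; rewrite /=.
  by move: cc => c; clear; lia.
by move: cc (size l) => c m; clear; nia.
Qed.

(** Clifford blocks are collected on the right: k l V k' = (k l V k^-1)(k k'). The conjugation by k
    is free, so only the T layers are paid for. *)
Lemma clifford_T_form_controlled n (w : circuit n) D T : (4 <= n)%N ->
  clifford_T_form w D T ->
  exists k V, [/\ clifford_circuit k, circuit_mx R w = V *m circuit_mx R k &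
    costs (controlled_mx V) ((50 * cc + 4) * D) ((50 * cc + 4) * T)].
Proof.
move=> le4; elim=> [k ck|k l w' D' T' ck hl _ [k' [V [ck' e hV]]]].
  exists k, 1%:M; rewrite mul1mx; split=> //; rewrite controlled1 !muln0.
  exact: (@costs_clifford R n.+1 [::]).
have [k2 ck2 e2] := clifford_inv R ck.
exists (k ++ k'), (circuit_mx R k *m (circuit_mx R l *m V) *m circuit_mx R k2); split.
- by rewrite clifford_cat ck.
- rewrite !circuit_cat e -!mulmxA; do 3!congr (_ *m _).
  by rewrite !mulmxA (mulmx1C e2) mul1mx.
apply: costs_conj => //; rewrite mulnS mulnDr.
by apply: costs_controlled_mul => //; apply: costs_controlled_layer.
Qed.

End ControlledLayer.

Theorem theorem6 :
  exists K : nat,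
    forall (R : realType) (n D C : nat) (U : 'M[R[i]]_(qdim n)),
      (4 <= n)%N ->
      U \is unitarymx ->
      (1 <= D)%N ->
      implements U D C ->
      exists D' C' : nat,
        [/\ (D' <= K * D)%N, (C' <= K * (C + n))%N
          & implements (controlled_mx U) D' C'].
Proof.
(* The layers account for 50 [clifford_cost] + 4. The single final Clifford adds depth
   [clifford_cost], absorbed using D >= 1, and T-count [clifford_cost] times n + 1, absorbed using n
   + 1 <= 2 n. *)
exists (52 * clifford_cost + 4)%N => R n D T U le4 _ D0 [w hw <-].
have [k [V [ck -> hV]]] := clifford_T_form_controlled R le4 hw.
have [D' [T' [leD leT hU]]] := costs_controlled_mul hV (costs_controlled_clifford R ck).
exists D', T'; split=> //; [apply: leq_trans leD _|apply: leq_trans leT _];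
  move: clifford_cost D0 le4; clear=> c D0 le4; nia.
Qed.
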